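(* Let $p$ be a prime $\equiv1\pmod6$, let $\omega=\exp(2\pi i/p)$, and let $x=(x_0,\dots,x_{p-1})$ be a bi-unimodular $p$-sequence of index $3$. Then there are a complex number $b$ of modulus one and integers $r$ and $l$ such that $x$ is given by $x_l=b\,\omega^{rl}$ and $x_j=b\,\omega^{rj}c_k$ when $0\ne j-l\in G_k$ $(k=0,1,2)$, where $c=(c_0,c_1,c_2)$ is one of the $12$ triples coming from the first or second canonical solution $c^{(1)}$, $c^{(2)}$. If $p\ne7$, there are $12p^2$ different normalized bi-unimodular $p$-sequences of index $3$ (i.e. with $x_0=1$). For $p=7$ there are $336$ different normalized bi-unimodular $7$-sequences of index $3$. Of these, $6\cdot7^2$ come from the second canonical solution, whereas only $6\cdot7$ come from the first canonical solution. The last-mentioned sequences can be uniquely written in the form $x_j=\omega^{mj^2+nj}$, where $m,n\in\mathbb{Z}_7$ and $m\ne0$.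
   Context: Indices of $p$-sequences are taken modulo $p$. A $p$-sequence $x\in\mathbb{C}^p$ is unimodular if $|x_j|=1$ for all $j$, and bi-unimodular if both $x$ and its normalized Fourier transform $\hat x_\nu=\frac1{\sqrt p}\sum_{j=0}^{p-1}x_j\omega^{j\nu}$ are unimodular. Cosets: let $g$ be a generator of the multiplicative group $\mathbb{Z}_p^*$, $s=(p-1)/3$, and $G_k=\{g^{k+3m}: m=0,\dots,s-1\}$ for $k=0,1,2$, so $G_0$ is the group of cubic residues and $G_1,G_2$ its other cosets. Let $n_{ik}$ be the number of $b\in\{1,\dots,p-1\}$ with $b\in G_i$ and $b+1\in G_k$. One always has $n_{01}\neq n_{02}$, and $g$ is chosen so that $n_{02}>n_{01}$ (this fixes which coset is $G_1$ and which is $G_2$). Index 3: $y\in\mathbb{C}^p$ is simple of index $3$ if there are complex numbers $c_0,c_1,c_2$ with $y_j=c_k$ whenever $0\ne j\in G_k$ $(k=0,1,2)$. A sequence $x\in\mathbb{C}^p$ has index $3$ if for some $r,l\in\mathbb{Z}_p$ and some simple $y$ of index $3$ one has $x_j=\omega^{rj}y_{j-l}$ for all $j$. Canonical solutions: let $A,B$ be the unique integers with $4p=A^2+27B^2$, $A\equiv1\pmod3$, $B>0$; put $u=\sqrt p$, $v=\sqrt{p+4A+16}$, $\theta=\frac13\operatorname{Arccos}\left(\frac{A}{2\sqrt p}\right)$ (one has $|u-4|<v<u+4$). For $i=1,2$ the $i$-th canonical solution is $c^{(i)}=(c^{(i)}_0,c^{(i)}_1,c^{(i)}_2)$ with $c^{(i)}_j=\alpha^{(i)}+\beta^{(i)}\cos(\theta-\frac{2\pi}3j)+\gamma^{(i)}\sin(\theta-\frac{2\pi}3j)$,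 where $$\alpha^{(1)}=\frac12\frac{pA-2p-2A}{p^2-3p-A}+i\frac{3\sqrt3}2\frac{\sqrt p\sqrt{p-4}B}{p^2-3p-A},\quad \beta^{(1)}=-\frac12\frac{\sqrt p(p-4)(A+2)}{p^2-3p-A}-i\frac{3\sqrt3}2\frac{\sqrt{p-4}(p-2)B}{p^2-3p-A},$$ $$\gamma^{(1)}=-\frac{3\sqrt3}2\frac{\sqrt p(p-4)B}{p^2-3p-A}+\frac i2\frac{\sqrt{p-4}(pA-2p-2A)}{p^2-3p-A},$$ $$\alpha^{(2)}=-\frac12\frac{u^2-uv-4}{u^2+uv+2}+\frac i2\frac{u\sqrt{4+u-v}\sqrt{4-u+v}}{u^2+uv+2},\quad \beta^{(2)}=\frac{(A+2)u}{u^2+uv+2}+\frac i4\frac{(u^2+uv+4)\sqrt{4+u-v}\sqrt{4-u+v}}{u^2+uv+2},$$ $$\gamma^{(2)}=\frac{3\sqrt3Bu}{u^2+uv+2}+\frac i4\frac{(u^2-uv-4)\sqrt{u+v+4}\sqrt{u+v-4}}{u^2+uv+2}.$$ The triples coming from a canonical solution $(c_0,c_1,c_2)$ are the six triples $(c_k,c_{k+1},c_{k+2})$ and $(1/c_k,1/c_{k+1},1/c_{k+2})$, $k=0,1,2$ (indices modulo $3$). A sequence $x$ ''comes from'' the $i$-th canonical solution if it has the form in the claim with $c$ one of the six triples coming from $c^{(i)}$. *)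

(* Defs.v *)
From HB Require Import structures.
From mathcomp Require Import all_boot all_order all_algebra all_fingroup all_solvable.
From mathcomp Require Import all_classical all_reals all_analysis.
From mathcomp Require Import complex.

Set Implicit Arguments.
Unset Strict Implicit.
Unset Printing Implicit Defensive.

Import Order.TTheory GRing.Theory Num.Theory.
Local Open Scope ring_scope.
Local Open Scope complex_scope.

(* A p-sequence is a function x : 'F_p -> R[i]; the type 'F_p carries the
   convention that indices are taken modulo p.  It has p elements when p is
   prime, which is always assumed below. *)

Definition omega (R : realType) (p : nat) : R[i] :=
  cos (2 * pi / p%:R) +i* sin (2 * pi / p%:R).

(* For a residue a modulo p, the exponent is its representative in
   {0, ..., p-1}; this is the usual omega^a since omega^p = 1. *)
Definition omega_pow (R : realType) (p : nat) (a : 'F_p) : R[i] :=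
  omega R p ^+ (nat_of_ord a).

Definition unimodular (R : realType) (p : nat) (x : 'F_p -> R[i]) : Prop :=
  forall j, `|x j| = 1.

Definition fourier (R : realType) (p : nat) (x : 'F_p -> R[i]) (nu : 'F_p) :
    R[i] :=
  (1 / Num.sqrt (p%:R : R))%:C * \sum_(j : 'F_p) x j * omega_pow R (j * nu).

Definition bi_unimodular (R : realType) (p : nat) (x : 'F_p -> R[i]) : Prop :=
  unimodular x /\ unimodular (fourier x).

Definition cubic_coset (p : nat) (g : {unit 'F_p}) (k : 'I_3) : {set 'F_p} :=
  [set FinRing.uval (g ^+ (k + 3 * m))%g | m : 'I_((p - 1) %/ 3)]%SET.

Definition ncoset (p : nat) (g : {unit 'F_p}) (i k : 'I_3) : nat :=
  #|[set b : 'F_p | [&& b != 0, b \in cubic_coset g i & b + 1 \in cubic_coset g k]]%SET|.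

Definition simple_index3 (R : realType) (p : nat) (g : {unit 'F_p})
    (y : 'F_p -> R[i]) : Prop :=
  exists c : 'I_3 -> R[i],
    forall (k : 'I_3) (j : 'F_p), j != 0 -> j \in cubic_coset g k -> y j = c k.

Definition index3 (R : realType) (p : nat) (g : {unit 'F_p})
    (x : 'F_p -> R[i]) : Prop :=
  exists (r l : 'F_p) (y : 'F_p -> R[i]),
    simple_index3 g y /\ forall j, x j = omega_pow R (r * j) * y (j - l).

Definition theta (R : realType) (p : nat) (A : int) : R :=
  3^-1 * acos (A%:~R / (2 * Num.sqrt p%:R)).

Definition triple_of (R : realType) (t : R) (alpha beta gamma : R[i])
    (j : 'I_3) : R[i] :=
  alpha + beta * (cos (t - 2 * pi / 3 * j%:R))%:C
        + gamma * (sin (t - 2 * pi / 3 * j%:R))%:C.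

Definition canonical1 (R : realType) (p : nat) (A B : int) : 'I_3 -> R[i] :=
  let P : R := p%:R in
  let a : R := A%:~R in
  let b : R := B%:~R in
  let D := P ^+ 2 - 3 * P - a in
  let alpha :=
    (1 / 2 * ((P * a - 2 * P - 2 * a) / D))
    +i* (3 * Num.sqrt 3 / 2 * (Num.sqrt P * Num.sqrt (P - 4) * b / D)) in
  let beta :=
    (- (1 / 2) * (Num.sqrt P * (P - 4) * (a + 2) / D))
    -i* (3 * Num.sqrt 3 / 2 * (Num.sqrt (P - 4) * (P - 2) * b / D)) in
  let gamma :=
    (- (3 * Num.sqrt 3 / 2) * (Num.sqrt P * (P - 4) * b / D))
    +i* (1 / 2 * (Num.sqrt (P - 4) * (P * a - 2 * P - 2 * a) / D)) in
  triple_of (theta R p A) alpha beta gamma.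

Definition canonical2 (R : realType) (p : nat) (A B : int) : 'I_3 -> R[i] :=
  let P : R := p%:R in
  let a : R := A%:~R in
  let b : R := B%:~R in
  let u := Num.sqrt P in
  let v := Num.sqrt (P + 4 * a + 16) in
  let E := u ^+ 2 + u * v + 2 in
  let w := Num.sqrt (4 + u - v) * Num.sqrt (4 - u + v) in
  let z := Num.sqrt (u + v + 4) * Num.sqrt (u + v - 4) in
  let alpha :=
    (- (1 / 2) * ((u ^+ 2 - u * v - 4) / E)) +i* (1 / 2 * (u * w / E)) in
  let beta :=
    ((a + 2) * u / E) +i* (1 / 4 * ((u ^+ 2 + u * v + 4) * w / E)) in
  let gamma :=
    (3 * Num.sqrt 3 * b * u / E)
    +i* (1 / 4 * ((u ^+ 2 - u * v - 4) * z / E)) in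
  triple_of (theta R p A) alpha beta gamma.

(* The sum k + j of indices in 'I_3 is taken modulo 3. *)
Definition triple_from (R : realType) (c t : 'I_3 -> R[i]) : Prop :=
  exists k : 'I_3,
    (forall j : 'I_3, t j = c (k + j)) \/
    (forall j : 'I_3, t j = 1 / c (k + j)).

Definition has_form (R : realType) (p : nat) (g : {unit 'F_p})
    (c : 'I_3 -> R[i]) (x : 'F_p -> R[i]) : Prop :=
  exists (b : R[i]) (r l : 'F_p),
    [/\ `|b| = 1,
        x l = b * omega_pow R (r * l) &
        forall (k : 'I_3) (j : 'F_p), j - l != 0 -> j - l \in cubic_coset g k ->
          x j = b * omega_pow R (r * j) * c k].

Definition comes_from (R : realType) (p : nat) (g : {unit 'F_p})
    (c : 'I_3 -> R[i]) (x : 'F_p -> R[i]) : Prop :=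
  exists t : 'I_3 -> R[i], triple_from c t /\ has_form g t x.

Definition normalized_solutions (R : realType) (p : nat) (g : {unit 'F_p}) :
    set ('F_p -> R[i]) :=
  [set x | [/\ bi_unimodular x, index3 g x & x 0 = 1]]%classic.

Arguments normalized_solutions R {p} g.

Definition normalized_solutions_from (R : realType) (p : nat)
    (g : {unit 'F_p}) (c : 'I_3 -> R[i]) : set ('F_p -> R[i]) :=
  [set x | normalized_solutions R g x /\ comes_from g c x]%classic.

(* Main.v *)
(* Write [y_0 = 1], [y_j = c_k] on the coset [G_k] and expand
   [c_k = a + b z^k + d z^-k] with [z = exp(2 i pi / 3)], that is
   [y = (1 - a) delta_0 + a + b chi + d chi^*] for the cubic character [chi].
   A unimodular sequence is bi-unimodular iff its nontrivial autocorrelations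
   vanish; for [y] they only involve the Jacobi sum
   [J = sum_j chi(j) chi(j+1) = (A - 3 sqrt(-3) B) / 2], and the problem becomes
     2 Re a + (p - 1) |a|^2 = 1,          |a|^2 + |b|^2 + |d|^2 = 1,
     a b^* + d a^* + b d^* = 0,           b^* + d + (1 + J) b d^* = 0.
   The last two equations express [b] and [d] through [a] and [q = b d^*], and
   determine [q^3] from [a]; the modulus of [q] then leaves a cubic equation
   for [Re a].  One root belongs to each canonical solution and the third one
   would make [Im a] imaginary.  The sign of [Im a] accounts for
   [c |-> 1 / c] and the choice of the cube root [q] for the cyclic shifts.
   If two simple sequences agree up to a modulation and a nonzero translation,
   their evenness turns them into quadratic chirps [omega^(m j^2)], which are
   constant on the cubic residues only for [p = 7]; chirps have
   [Re a = -1/6] and belong to the first canonical solution. *)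
Require Import Defs.
From mathcomp Require Import all_boot all_order all_algebra all_fingroup all_solvable.
From mathcomp Require Import all_classical all_reals all_analysis.
From mathcomp Require Import complex.
From mathcomp Require Import ring lra zify.
Set Implicit Arguments.
Unset Strict Implicit.
Unset Printing Implicit Defensive.
Import Order.TTheory GRing.Theory Num.Theory.
Local Open Scope ring_scope.
Local Open Scope complex_scope.
(* Overrides [conjc], so that a single conjugation is used in both scopes. *)
Local Notation "z ^*" := (Num.conj z) : complex_scope.
Local Notation Re := complex.Re.
Local Notation Im := complex.Im.

(** The cubic for [Re a] is never solved. Each of its two admissible factors is kept as a linear
    equation: every solution of the system satisfies one of them, each canonical triple satisfies
    its own, and they have no common root. Since [Re a] determines a triple up to the six
    symmetries, this identifies every solution. The canonical triples can be checked by rational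
    identities because [theta] is a third of an arccosine: in the coordinates [a], [b], [d] the
    angle survives only in [exp (3 i theta)], which is [J^* / sqrt p]. The sign of [Im J] must be
    known for this, and it is what the choice [n_02 > n_01] fixes. [J] itself is expressed by the
    numbers [n_ik] and then pinned down by its norm [p] and the uniqueness of [4 p = A^2 + 27 B^2].
    For [p = 7] the count drops because a translated chirp is a modulated chirp up to a scalar, so
    the [49] pairs of modulation and translation collapse to [7] sequences. *)

Lemma conjM (R : realType) (x y : R[i]) : (x * y)^* = x^* * y^*.
Proof. exact: rmorphM. Qed.

Lemma conjD (R : realType) (x y : R[i]) : (x + y)^* = x^* + y^*.
Proof. exact: rmorphD. Qed.

Lemma conjB (R : realType) (x y : R[i]) : (x - y)^* = x^* - y^*.
Proof. exact: rmorphB. Qed.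

Lemma conjX (R : realType) (x : R[i]) n : (x ^+ n)^* = x^* ^+ n.
Proof. exact: rmorphXn. Qed.

Lemma conj_sum (R : realType) (I : finType) (P : pred I) (F : I -> R[i]) :
  (\sum_(i | P i) F i)^* = \sum_(i | P i) (F i)^*.
Proof. exact: rmorph_sum. Qed.

Lemma conj_real (R : realType) (x : R) : (x%:C)^* = x%:C.
Proof. exact: conjc_real. Qed.

Lemma realcD (R : realType) (x y : R) : (x + y)%:C = x%:C + y%:C.
Proof. exact: rmorphD. Qed.

Lemma realcB (R : realType) (x y : R) : (x - y)%:C = x%:C - y%:C.
Proof. exact: rmorphB. Qed.

Lemma realcM (R : realType) (x y : R) : (x * y)%:C = x%:C * y%:C.
Proof. exact: rmorphM. Qed.

Lemma norm1_conj (R : realType) (z : R[i]) : `|z| = 1 -> z * z^* = 1.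
Proof. by move=> hz; rewrite -normCK hz expr1n. Qed.

Lemma conj_norm1 (R : realType) (z : R[i]) : z * z^* = 1 -> `|z| = 1.
Proof.
move=> hz; apply/eqP; rewrite -(@eqrXn2 _ 2) ?expr1n ?normr_ge0 ?ler01 //.
by rewrite normCK hz.
Qed.

Lemma invc_norm1 (R : realType) (z : R[i]) : `|z| = 1 -> z^-1 = z^*.
Proof.
move=> hz; apply: (@mulfI _ z); first by rewrite -normr_eq0 hz oner_eq0.
by rewrite norm1_conj // divff // -normr_eq0 hz oner_eq0.
Qed.

Lemma expi_exp (R : realType) (t : R) n :
  (cos t +i* sin t) ^+ n = cos (t *+ n) +i* sin (t *+ n).
Proof.
elim: n => [|n IH]; first by rewrite expr0 mulr0n cos0 sin0.
rewrite exprS IH mulrS cosD sinD; apply/eqP; rewrite eq_complex /=.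
by rewrite eqxx /=; apply/eqP; ring.
Qed.

Lemma expi_norm (R : realType) (t : R) : `|cos t +i* sin t| = 1.
Proof. by rewrite normc_def /= cos2Dsin2 sqrtr1. Qed.

Lemma omega_expp (R : realType) (p : nat) : (0 < p)%N -> omega R p ^+ p = 1.
Proof.
move=> p0; rewrite expi_exp -[X in cos X]mulr_natr -[X in sin X]mulr_natr.
by rewrite mulfVK ?pnatr_eq0 -?lt0n // mulr_natl cos2pi sin2pi.
Qed.

Lemma omega_neq1 (R : realType) (p : nat) : (1 < p)%N -> omega R p != 1.
Proof.
move=> p1; have p0 : (0 : R) < p%:R by rewrite ltr0n ltnW.
have pi0 := pi_gt0 R.
rewrite eq_complex /= negb_and; apply/orP.
have [->|pn2] := eqVneq p 2%N.
  by left; rewrite mulrC mulKf ?pnatr_eq0 // cospi; apply/eqP; lra.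
have p3 : (3 : R) <= p%:R by rewrite ler_nat ltn_neqAle eq_sym pn2.
right; rewrite gt_eqF // sin_gt0_pi // divr_gt0 ?mulr_gt0 //=.
by rewrite ltr_pdivrMr // mulrC ltr_pM2l //; lra.
Qed.

Lemma expr_modp (T : pzSemiRingType) (w : T) p n : w ^+ p = 1 -> w ^+ (n %% p) = w ^+ n.
Proof.
by move=> h; rewrite {2}(divn_eq n p) exprD mulnC exprM h expr1n mul1r.
Qed.

(** * Autocorrelation and the Fourier transform *)

Section OmegaPow.
Context (R : realType) (p : nat) (p_prime : prime p).
Local Notation e := (@omega_pow R p).

Lemma omega_powD a b : e (a + b) = e a * e b.
Proof.
rewrite /omega_pow -exprD; apply: expr_modp.
by rewrite Fp_cast // omega_expp // prime_gt0.
Qed.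

Lemma omega_pow0 : e 0 = 1.
Proof. by []. Qed.

Lemma omega_pow_norm a : `|e a| = 1.
Proof. by rewrite /omega_pow normrX expi_norm expr1n. Qed.

Lemma omega_pow_neq0 a : e a != 0.
Proof. by rewrite -normr_eq0 omega_pow_norm oner_eq0. Qed.

Lemma omega_powN a : e (- a) = (e a)^*.
Proof.
rewrite -invc_norm1 ?omega_pow_norm //.
by apply: (mulfI (omega_pow_neq0 a)); rewrite -omega_powD subrr divff ?omega_pow_neq0.
Qed.

Lemma omega_powMn a n : e (a *+ n) = e a ^+ n.
Proof. by elim: n => [|n IH]; rewrite ?mulrS ?omega_powD ?IH ?exprS. Qed.

Lemma omega_pow1 : e 1 = omega R p.
Proof. by rewrite /omega_pow /= Fp_cast // modn_small ?prime_gt1 // expr1. Qed.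

Lemma omega_pow_eq1 a : e a = 1 -> a = 0.
Proof.
move=> ea; apply/eqP; apply/negP => /negP a0.
have := omega_neq1 R (prime_gt1 p_prime); rewrite -omega_pow1 => /eqP; case.
(* [a^-1] is read as a natural number: [1] is a multiple of [a], so [e a = 1] would force
   [omega = 1]. *)
have -> : (1 : 'F_p) = a *+ (a^-1 : 'F_p).
  by rewrite -mulr_natr natr_Zp divff.
by rewrite omega_powMn ea expr1n.
Qed.

Lemma omega_pow_inj a b : e a = e b -> a = b.
Proof.
move=> eab; apply/eqP; rewrite -subr_eq0; apply/eqP; apply: omega_pow_eq1.
by rewrite omega_powD omega_powN eab norm1_conj ?omega_pow_norm.
Qed.

Lemma sum_omega_pow a : a != 0 -> \sum_nu e (a * nu) = 0.
Proof.
move=> a0; set S := \sum_nu _.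
have hS : e a * S = S.
  rewrite /S mulr_sumr [RHS](reindex_inj (addIr 1)) /=; apply: eq_bigr => i _.
  by rewrite mulrDr mulr1 omega_powD mulrC.
have : (e a - 1) * S = 0 by rewrite mulrBl hS mul1r subrr.
move/eqP; rewrite mulf_eq0 subr_eq0 => /orP[/eqP/omega_pow_eq1/eqP|/eqP //].
by rewrite (negbTE a0).
Qed.

Definition autocorr (x : 'F_p -> R[i]) (m : 'F_p) := \sum_j x (j + m) * (x j)^*.

(** The Wiener-Khinchin identity, by the substitution of [j + m] for one of the two summation
    indices. *)
Lemma fourier_sqr (x : 'F_p -> R[i]) nu :
  fourier x nu * (fourier x nu)^* =
  (p%:R)^-1 * \sum_m autocorr x m * e (m * nu).
Proof.
have hc : (1 / Num.sqrt (p%:R : R))%:C * (1 / Num.sqrt (p%:R : R))%:C = (p%:R)^-1 :> R[i].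
  rewrite -rmorphM -expr2 expr_div_n sqr_sqrtr ?ler0n //.
  by rewrite expr1n div1r fmorphV rmorph_nat.
rewrite /fourier conjM conj_real mulrACA hc; congr (_ * _).
rewrite conj_sum mulr_suml /autocorr.
under [RHS]eq_bigr => m _ do rewrite mulr_suml.
under [LHS]eq_bigr => j _ do rewrite mulr_sumr.
rewrite exchange_big [RHS]exchange_big /=; apply: eq_bigr => j _.
rewrite (reindex_inj (addrI j)) /=; apply: eq_bigr => m _.
rewrite conjM -omega_powN.
rewrite mulrACA -omega_powD; congr (_ * e _); ring.
Qed.

(** A flat spectrum means that the autocorrelation has a constant transform, and Fourier inversion
    then leaves only its value at [0], which is [p] for a unimodular sequence. *)
Lemma bi_unimodularP (x : 'F_p -> R[i]) :
  bi_unimodular x <-> unimodular x /\ forall m, m != 0 -> autocorr x m = 0.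
Proof.
have p0 : (p%:R : R[i]) != 0 by rewrite pnatr_eq0 -lt0n prime_gt0.
split=> -[ux h]; split=> //.
- move=> m m0.
  have hS nu : \sum_k autocorr x k * e (k * nu) = p%:R.
    have := norm1_conj (h nu); rewrite fourier_sqr => hh.
    by rewrite -[LHS](mulVKf p0) hh mulr1.
  have : \sum_nu (\sum_k autocorr x k * e (k * nu)) * e (- m * nu) = 0.
    by under eq_bigr => nu _ do rewrite hS; rewrite -mulr_sumr sum_omega_pow ?mulr0 ?oppr_eq0.
  under eq_bigr => nu _ do rewrite mulr_suml.
  rewrite exchange_big /= (bigD1 m) //= [X in _ + X]big1 ?addr0.
    under eq_bigr => i _ do rewrite -mulrA -omega_powD mulNr subrr omega_pow0 mulr1.
    rewrite sumr_const card_Fp // -mulr_natr => /eqP.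
    by rewrite mulf_eq0 (negbTE p0) orbF => /eqP.
  move=> i im; under eq_bigr => nu _ do rewrite -mulrA -omega_powD -mulrDl.
  by rewrite -mulr_sumr sum_omega_pow ?mulr0 // subr_eq0.
- move=> nu; apply: conj_norm1; rewrite fourier_sqr (bigD1 0) //= big1 ?addr0.
    rewrite mul0r omega_pow0 mulr1 /autocorr.
    under eq_bigr => j _ do rewrite addr0 norm1_conj ?ux //.
    by rewrite sumr_const card_Fp // mulVf.
  by move=> i i0; rewrite h // mul0r.
Qed.

Definition twist (b : R[i]) (r l : 'F_p) (y : 'F_p -> R[i]) : 'F_p -> R[i] :=
  fun j => b * e (r * j) * y (j - l).

(** A twist only multiplies the autocorrelation at [m] by the phase [e (r * m)]. *)
Lemma bi_unimodular_twist b r l y : `|b| = 1 ->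
  bi_unimodular (twist b r l y) <-> bi_unimodular y.
Proof.
move=> b1.
have hc m : autocorr (twist b r l y) m = e (r * m) * autocorr y m.
  rewrite /autocorr mulr_sumr [RHS](reindex_inj (addIr (- l))) /=.
  apply: eq_bigr => j _; rewrite /twist !conjM -omega_powN.
  have -> : j + m - l = j - l + m by ring.
  rewrite -[RHS]mul1r -(norm1_conj b1).
  have -> : e (r * (j + m)) = e (r * m) * e (r * j) by rewrite -omega_powD; congr e; ring.
  have := omega_powD (r * j) (- (r * j)); rewrite subrr omega_pow0 => h.
  rewrite -[RHS]mul1r h; ring.
rewrite !bi_unimodularP; split=> -[u h]; split=> [j|m m0].
- have := u (j + l); rewrite /twist !normrM b1 omega_pow_norm !mul1r.
  by rewrite addrK.
- have := h m m0; rewrite hc => /eqP.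
  by rewrite mulf_eq0 (negbTE (omega_pow_neq0 _)) => /eqP.
- by rewrite /twist !normrM b1 omega_pow_norm !mul1r u.
- by rewrite hc h // mulr0.
Qed.

End OmegaPow.

(** * The canonical solutions as solutions of the system *)

Section Canonical1.
Context (R : realType) (p A u r h x1 x2 b1 b2 c1 c2 : R).
Let D := p ^+ 2 - 3 * p - A.
Let N := p * A - 2 * p - 2 * A.
Hypotheses (D0 : D != 0).
Hypotheses (pE : p = u ^+ 2) (rE : r ^+ 2 = u ^+ 2 - 4) (hE : h ^+ 2 = 4 * u ^+ 2 - A ^+ 2).
Hypotheses (x1E : x1 = N / (2 * D)) (x2E : x2 = u * r * h / (2 * D))
  (b1E : b1 = - (u * (p - 4) * (A + 2)) / (2 * D))
  (b2E : b2 = - (r * (p - 2) * h) / (2 * D))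
  (c1E : c1 = - (u * (p - 4) * h) / (2 * D)) (c2E : c2 = r * N / (2 * D)).

(** The system in real coordinates, once [cos (3 theta)] and [sin (3 theta)] are replaced by
    [A / (2 u)] and [h / (2 u)]. The pairs [x], [b], [c] are the real and imaginary parts of
    [alpha], [beta], [gamma]; [r] is [sqrt (p - 4)] and [h] is [3 sqrt 3 B]. *)
Lemma canonical1_real :
  [/\ 2 * x1 + (p - 1) * (x1 ^+ 2 + x2 ^+ 2) = 1,
      2 * (x1 ^+ 2 + x2 ^+ 2) + (b1 ^+ 2 + b2 ^+ 2 + c1 ^+ 2 + c2 ^+ 2) = 2,
      4 * (x1 * b1 + x2 * b2) * (2 * u) + (b1 ^+ 2 + b2 ^+ 2 - c1 ^+ 2 - c2 ^+ 2) * A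
        + 2 * (b1 * c1 + b2 * c2) * h = 0
    & - 4 * (x1 * c1 + x2 * c2) * (2 * u) + 2 * (b1 * c1 + b2 * c2) * A
        - (b1 ^+ 2 + b2 ^+ 2 - c1 ^+ 2 - c2 ^+ 2) * h = 0] /\
  (b1 = (1 + A / 2) * (x1 * b1 + x2 * b2) - h / 2 * (x1 * c1 + x2 * c2) /\
   c1 = (1 + A / 2) * (x1 * c1 + x2 * c2) + h / 2 * (x1 * b1 + x2 * b2)).
Proof.
have D' : (u ^+ 2) ^+ 2 - 3 * u ^+ 2 - A != 0 by move: D0; rewrite /D pE.
rewrite x1E x2E b1E b2E c1E c2E /N /D pE.
by do !split; field : rE hE.
Qed.

End Canonical1.

Section Canonical2.
Context (R : realType) (p A u v w z h x1 x2 b1 b2 c1 c2 : R).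
Let E := u ^+ 2 + u * v + 2.
Hypotheses (E0 : E != 0).
Hypotheses (pE : p = u ^+ 2) (vE : v ^+ 2 = u ^+ 2 + 4 * A + 16)
  (wE : w ^+ 2 = 16 - (u - v) ^+ 2) (zE : z ^+ 2 = (u + v) ^+ 2 - 16)
  (wzE : w * z = 4 * h).
Hypotheses (x1E : x1 = - (u ^+ 2 - u * v - 4) / (2 * E)) (x2E : x2 = u * w / (2 * E))
  (b1E : b1 = (A + 2) * u / E)
  (b2E : b2 = (u ^+ 2 + u * v + 4) * w / (4 * E))
  (c1E : c1 = h * u / E) (c2E : c2 = (u ^+ 2 - u * v - 4) * z / (4 * E)).

(** Solving [vE] for [A] and [wzE] for [h] makes everything rational in [u], [v], [w], [z], where
    only the squares of [w] and [z] have to be reduced. *)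
Lemma canonical2_real :
  [/\ 2 * x1 + (p - 1) * (x1 ^+ 2 + x2 ^+ 2) = 1,
      2 * (x1 ^+ 2 + x2 ^+ 2) + (b1 ^+ 2 + b2 ^+ 2 + c1 ^+ 2 + c2 ^+ 2) = 2,
      4 * (x1 * b1 + x2 * b2) * (2 * u) + (b1 ^+ 2 + b2 ^+ 2 - c1 ^+ 2 - c2 ^+ 2) * A
        + 2 * (b1 * c1 + b2 * c2) * h = 0
    & - 4 * (x1 * c1 + x2 * c2) * (2 * u) + 2 * (b1 * c1 + b2 * c2) * A
        - (b1 ^+ 2 + b2 ^+ 2 - c1 ^+ 2 - c2 ^+ 2) * h = 0] /\
  (b1 = (1 + A / 2) * (x1 * b1 + x2 * b2) - h / 2 * (x1 * c1 + x2 * c2) /\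
   c1 = (1 + A / 2) * (x1 * c1 + x2 * c2) + h / 2 * (x1 * b1 + x2 * b2)).
Proof.
have AE : A = (v ^+ 2 - u ^+ 2 - 16) / 4 by rewrite vE; field.
have hE : h = w * z / 4 by rewrite wzE; field.
have wE' : w ^+ 2 = 16 - u ^+ 2 + 2 * u * v - v ^+ 2 by rewrite wE; ring.
have zE' : z ^+ 2 = u ^+ 2 + 2 * u * v + v ^+ 2 - 16 by rewrite zE; ring.
have E' : u ^+ 2 + u * v + 2 != 0 by [].
rewrite x1E x2E b1E b2E c1E c2E /E hE AE pE.
by do !split; field : wE' zE'.
Qed.

End Canonical2.

(* The factorisation behind the list of solutions: the first factor gives the
   first canonical solution, the second one splits over [sqrt p * v]. *)
Lemma real_part_factor (R : realType) (p A x y : R) :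
  p != 1 -> 2 * x + (p - 1) * (x ^+ 2 + y ^+ 2) = 1 ->
  let rho := x ^+ 2 + y ^+ 2 in
  let T := rho * (1 + A + p) - 2 * x * (1 + A / 2) + 1 in
  (1 - rho) * (T ^+ 2 - y ^+ 2 * (4 * p - A ^+ 2)) = 8 * y ^+ 2 * T ->
  (2 * (p ^+ 2 - 3 * p - A) * x - (p * A - 2 * p - 2 * A)) *
  ((2 * x * (p + 2) + p - 4) ^+ 2 - p * (p + 4 * A + 16) * (1 - 2 * x) ^+ 2) = 0.
Proof.
move=> p1 hx rho T hT.
have p1' : p - 1 != 0 by rewrite subr_eq0.
have rE : rho = (1 - 2 * x) / (p - 1).
  by apply: (mulIf p1'); rewrite divfK // /rho; lra.
have y2 : y ^+ 2 = (1 - 2 * x) / (p - 1) - x ^+ 2 by rewrite -rE /rho; ring.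
transitivity (4 * (p - 1) ^+ 3 *
  ((1 - rho) * (T ^+ 2 - y ^+ 2 * (4 * p - A ^+ 2)) - 8 * y ^+ 2 * T)); last first.
  by rewrite hT subrr mulr0.
by rewrite /T y2 rE; field; rewrite p1'.
Qed.

(** The other sign reads [t m = 2 (p - 1)] with [t = 1 - 2 x] and [m = p + 2 - u v]. Inserting this
    into the equation for [y] gives [4 m^2 y^2 = p (16 - (u + v)^2)], which is negative. *)
Lemma real_part_branch (R : realType) (p A u v x y : R) :
  1 < p -> 0 < u -> u ^+ 2 = p -> 0 <= v -> v ^+ 2 = p + 4 * A + 16 -> 4 < u + v ->
  2 * x + (p - 1) * (x ^+ 2 + y ^+ 2) = 1 -> y != 0 ->
  (2 * x * (p + 2) + p - 4) ^+ 2 - p * (p + 4 * A + 16) * (1 - 2 * x) ^+ 2 = 0 ->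
  2 * x * (p + 2) + p - 4 = u * v * (1 - 2 * x).
Proof.
move=> p1 u0 uE v0 vE uv hx y0 hQ.
have : (2 * x * (p + 2) + p - 4 - u * v * (1 - 2 * x)) *
       (2 * x * (p + 2) + p - 4 + u * v * (1 - 2 * x)) = 0.
  by rewrite -hQ -vE -uE; ring.
move/eqP; rewrite mulf_eq0 => /orP[/eqP h|/eqP h]; first by apply/eqP; rewrite -subr_eq0 h.
have Y0 : 0 < (p - 1) * y ^+ 2.
  by rewrite mulr_gt0 ?subr_gt0 // lt_def sqr_ge0 expf_eq0 y0.
have t0 : 0 < 1 - 2 * x.
  have : 0 <= (p - 1) * x ^+ 2 by rewrite mulr_ge0 ?sqr_ge0 // subr_ge0 ltW.
  lra.
pose t := 1 - 2 * x; pose m := p + 2 - u * v.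
have tm : t * m = 2 * (p - 1).
  by rewrite /t /m; lra.
have hY : 4 * t - (p - 1) * (1 - t) ^+ 2 = 4 * ((p - 1) * y ^+ 2).
  by rewrite /t; lra.
have m0 : 0 < m.
  by rewrite -(pmulr_rgt0 _ t0) -/t tm mulr_gt0 // subr_gt0.
have : 0 < m ^+ 2 * (4 * t - (p - 1) * (1 - t) ^+ 2).
  by rewrite hY; apply: mulr_gt0; [exact: exprn_gt0 | apply: mulr_gt0].
have -> : m ^+ 2 * (4 * t - (p - 1) * (1 - t) ^+ 2)
   = 4 * m * (t * m) - (p - 1) * (m - t * m) ^+ 2 by ring.
rewrite tm.
have -> : 4 * m * (2 * (p - 1)) - (p - 1) * (m - 2 * (p - 1)) ^+ 2
  = (p - 1) * (u ^+ 2 * (16 - (u + v) ^+ 2)).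
  by rewrite /m -uE; ring.
rewrite pmulr_rgt0 ?subr_gt0 // pmulr_rgt0 ?exprn_gt0 // subr_gt0 => h2.
have : 4 * 4 < (u + v) * (u + v) by rewrite ltr_pM.
by lra.
Qed.

(** * The system for the coordinates of a triple *)

Section System.
Context (R : realType) (p A h : R).
Hypotheses (p4 : 4 < p) (h0 : h != 0) (hE : h ^+ 2 = 4 * p - A ^+ 2).

(* With [h = 3 sqrt 3 B], this is 1 plus the Jacobi sum of [chi]. *)
Definition jac1 : R[i] := (1 + A / 2) -i* (h / 2).
Local Notation K := jac1.

Definition solves (a b d : R[i]) :=
  [/\ a + a^* + (p - 1)%:C * (a * a^*) = 1,
      a * a^* + b * b^* + d * d^* = 1,
      a * b^* + d * a^* + b * d^* = 0
    & b^* + d + K * (b * d^*) = 0].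

Lemma complexP (z z' : R[i]) : Re z = Re z' -> Im z = Im z' -> z = z'.
Proof. by case: z z' => [x y] [x' y'] /= -> ->. Qed.

Lemma mul_conj (z : R[i]) : z * z^* = (Re z ^+ 2 + Im z ^+ 2)%:C.
Proof. by case: z => x y; apply: complexP => /=; ring. Qed.

Lemma solves_real a b d : solves a b d ->
  2 * Re a + (p - 1) * (Re a ^+ 2 + Im a ^+ 2) = 1 :> R.
Proof.
case=> + _ _ _; case: a => x y /= /(congr1 (@Re R)) /= e; rewrite -[RHS]e; ring.
Qed.

(** If [b d^* = 0], the last equation gives [b^* = - d], so both vanish and [|a| = 1]; then
    [2 Re a = 2 - p < -2], which is impossible. *)
Lemma solves_q_neq0 a b d : solves a b d -> b * d^* != 0.
Proof.
move=> sol; apply/negP => /eqP q0.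
have hr := solves_real sol; case: sol => _ h2 h3 h4.
have hb : b^* = - d by move: h4; rewrite q0 mulr0 addr0 => /eqP; rewrite addr_eq0 => /eqP.
have d0 : d = 0.
  move/eqP: q0; rewrite mulf_eq0 => /orP[/eqP b0|].
    by apply/eqP; rewrite -oppr_eq0 -hb b0 conjC0.
  by rewrite conjC_eq0 => /eqP.
have b0 : b = 0 by apply/eqP; rewrite -conjC_eq0 hb d0 oppr0.
move: h2; rewrite b0 d0 !mul0r !addr0 mul_conj => /(congr1 (@Re R)) /= h2.
move: hr; rewrite h2 mulr1 => hr.
case: (a) hr h2 => x y /= hr h2.
have y2 : 0 <= y ^+ 2 by exact: sqr_ge0.
have p4' := p4.
have x1 : x < - 1 by lra.
have : 0 < (- 1 - x) * (1 - x) by rewrite mulr_gt0 ?subr_gt0 //; lra.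
by lra.
Qed.

(** For a fixed value of [b d^*] the last two equations are linear in [b^*] and [d], with
    determinant [a^* - a] up to sign; here [b^*] is eliminated. *)
Lemma solves_dE a b d : solves a b d ->
  d * (a^* - a) = b * d^* * (a * K - 1).
Proof.
case=> _ _ h3 h4.
apply/eqP; rewrite -subr_eq0; apply/eqP.
transitivity ((a * b^* + d * a^* + b * d^*) - a * (b^* + d + K * (b * d^*))); first by ring.
by rewrite h3 h4 mulr0 subr0.
Qed.

Lemma solves_bE a b d : solves a b d ->
  b^* * (a^* - a) = b * d^* * (1 - a^* * K).
Proof.
case=> _ _ h3 h4.
apply/eqP; rewrite -subr_eq0; apply/eqP.
transitivity (a^* * (b^* + d + K * (b * d^*)) - (a * b^* + d * a^* + b * d^*)); first by ring.
by rewrite h3 h4 mulr0 subr0.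
Qed.

(** For real [a], [solves_dE] would force [a K = 1], but [K] is not real because [h != 0]. *)
Lemma solves_Im_neq0 a b d : solves a b d -> Im a != 0.
Proof.
move=> sol; apply/negP => /eqP y0.
have q0 := solves_q_neq0 sol.
have ar : a^* = a by case: (a) y0 => x y /= ->; apply: complexP; rewrite /= ?oppr0.
have := solves_dE sol; rewrite ar subrr mulr0 => /esym/eqP.
rewrite mulf_eq0 (negbTE q0) /= subr_eq0 => /eqP.
case: (a) y0 => x y /= -> /eqP; rewrite eq_complex /= => /andP[/eqP hx /eqP hy].
have : x * h = 0 by lra.
move/eqP; rewrite mulf_eq0 (negbTE h0) orbF => /eqP x0.
by move: hx; rewrite x0 !mul0r subr0 => /esym/eqP; rewrite oner_eq0.
Qed.

(** The product of [solves_dE] and [solves_bE], since [d b^*] is the conjugate of [b d^*]. *)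
Lemma solves_qE a b d : solves a b d ->
  (4 * Im a ^+ 2)%:C * (b * d^*)^* = (b * d^*) ^+ 2 * ((a * K - 1) * (a^* * K - 1)).
Proof.
move=> sol.
have -> : (4 * Im a ^+ 2)%:C = - (a^* - a) ^+ 2.
  by case: (a) => x y; apply: complexP => /=; ring.
transitivity (- (d * (a^* - a)) * (b^* * (a^* - a))); last first.
  by rewrite (solves_dE sol) (solves_bE sol); ring.
by rewrite conjM conjCK; ring.
Qed.

Lemma jac1_norm (x y : R) :
  let rho := x ^+ 2 + y ^+ 2 in
  ((x +i* y) * K - 1) * ((x +i* y) * K - 1)^* =
  (rho * (1 + A + p) - 2 * x * (1 + A / 2) + 1 - h * y)%:C.
Proof.
rewrite mul_conj /=; congr (_%:C).
have -> : p = (h ^+ 2 + A ^+ 2) / 4 by rewrite hE; field.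
by field.
Qed.

(** [Q = |q|^2] is eliminated between two relations: the norm of [solves_qE], and the second
    equation of the system with [|b|^2] and [|d|^2] taken from [solves_bE] and [solves_dE]. [M] and
    [N] are the squared moduli of [a K - 1] and [a^* K - 1]. *)
Lemma solves_cubic a b d : solves a b d ->
  let rho := Re a ^+ 2 + Im a ^+ 2 in
  let T := rho * (1 + A + p) - 2 * Re a * (1 + A / 2) + 1 in
  (1 - rho) * (T ^+ 2 - Im a ^+ 2 * (4 * p - A ^+ 2)) = 8 * Im a ^+ 2 * T :> R.
Proof.
move=> sol rho T.
have [q qE] : {q | q = b * d^*} by exists (b * d^*).
set Q := q * q^*.
set M := T - h * Im a; set N := T + h * Im a.
have y0 := solves_Im_neq0 sol.
have Q0 : Q != 0 by rewrite mulf_neq0 ?conjC_eq0 //; rewrite qE; exact: solves_q_neq0 sol.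
have y20 : (4 * Im a ^+ 2)%:C != 0.
  by apply/eqP => -[/eqP]; rewrite mulf_eq0 pnatr_eq0 /= expf_eq0 (negbTE y0).
have hM : (a * K - 1) * (a * K - 1)^* = M%:C.
  by rewrite /M /T /rho; case: (a) => x1 y1; rewrite jac1_norm.
have hN : (a^* * K - 1) * (a^* * K - 1)^* = N%:C.
  rewrite /N /T /rho; case: (a) => x1 y1; rewrite [(_ +i* _)^*]/= jac1_norm /=.
  by congr (_%:C); ring.
have hD : (a^* - a) * (a^* - a)^* = (4 * Im a ^+ 2)%:C.
  by case: (a) => x y; apply: complexP => /=; ring.
have e1 : ((4 * Im a ^+ 2)%:C) ^+ 2 = Q * (M%:C * N%:C).
  apply: (mulIf Q0).
  have := solves_qE sol; rewrite -qE => e.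
  transitivity (((4 * Im a ^+ 2)%:C * q^*) * ((4 * Im a ^+ 2)%:C * q^*)^*).
    by rewrite conjM conjCK conj_real /Q; ring.
  by rewrite e -hM -hN !conjM /Q; ring.
have e2 : (1 - rho)%:C * (4 * Im a ^+ 2)%:C = Q * (M + N)%:C.
  have hb : b * b^* * (4 * Im a ^+ 2)%:C = Q * N%:C.
    rewrite -hD -hN; transitivity ((b^* * (a^* - a)) * (b^* * (a^* - a))^*).
      by rewrite !conjM !conjB !conjCK; ring.
    by rewrite (solves_bE sol) -qE /Q !conjM !conjB !conjM conjC1; ring.
  have hd : d * d^* * (4 * Im a ^+ 2)%:C = Q * M%:C.
    rewrite -hD -hM; transitivity ((d * (a^* - a)) * (d * (a^* - a))^*).
      by rewrite !conjM; ring.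
    by rewrite (solves_dE sol) -qE /Q !conjM !conjB !conjM conjC1; ring.
  rewrite [(M + N)%:C]realcD mulrDr -hb -hd -mulrDl; congr (_ * _).
  case: sol => _ h2 _ _; by rewrite realcB -mul_conj -[1%:C]/(1 : R[i]) -h2; ring.
have : ((1 - rho) * (4 * Im a ^+ 2) * (M * N))%:C = ((4 * Im a ^+ 2) ^+ 2 * (M + N))%:C.
  move: e1 e2; move: (4 * Im a ^+ 2) (1 - rho) (M + N) => Y r S e1 e2.
  by rewrite expr2 !realcM e2 -expr2 e1; ring.
move=> /(congr1 (@Re R)) /= e3.
have y2 : 4 * Im a ^+ 2 != 0 by rewrite mulf_neq0 ?pnatr_eq0 // expf_neq0.
apply: (mulfI y2).
have -> : T ^+ 2 - Im a ^+ 2 * (4 * p - A ^+ 2) = M * N by rewrite -hE /M /N; ring.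
rewrite mulrA [4 * _ * _]mulrC e3 /M /N; ring.
Qed.

End System.

(** * Cube roots of unity *)

Section CubeRoot.
Context (R : realType).

Definition zeta : R[i] := omega R 3.

Lemma zeta3 : zeta ^+ 3 = 1.
Proof. exact: omega_expp. Qed.

Lemma zeta_sum : 1 + zeta + zeta ^+ 2 = 0.
Proof.
have : (zeta - 1) * (1 + zeta + zeta ^+ 2) = 0.
  by rewrite -[RHS](subrr (1 : R[i])) -{3}zeta3; ring.
move/eqP; rewrite mulf_eq0 subr_eq0 (negbTE (omega_neq1 R _)) //= => /eqP //.
Qed.

Lemma zeta_norm n : zeta ^+ n * (zeta ^+ n)^* = 1.
Proof. by rewrite norm1_conj // normrX expi_norm expr1n. Qed.

Lemma zeta_conj : zeta^* = zeta ^+ 2.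
Proof.
rewrite -invc_norm1 ?expi_norm //.
have z0 : zeta != 0 by rewrite -normr_eq0 expi_norm oner_eq0.
by apply: (mulfI z0); rewrite divff // -exprS zeta3.
Qed.

Lemma cube_eq1 (z : R[i]) : z ^+ 3 = 1 -> exists k : 'I_3, z = zeta ^+ k.
Proof.
move=> z3; have : (z - 1) * (z - zeta) * (z - zeta ^+ 2) = 0.
  have z2 : zeta ^+ 2 = - 1 - zeta.
    by apply/eqP; rewrite -subr_eq0; apply/eqP; rewrite -[RHS]zeta_sum; ring.
  transitivity (z ^+ 3 - 1); last by rewrite z3 subrr.
  by rewrite z2; ring : z2.
move/eqP; rewrite !mulf_eq0 !subr_eq0 -orbA => /or3P[] /eqP ->.
- by exists 0.
- by exists 1.
- by exists (inord 2); rewrite inordK.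
Qed.

End CubeRoot.

Section SystemSolutions.
Context (R : realType) (p A h : R).
Hypotheses (p4 : 4 < p) (h0 : h != 0) (hE : h ^+ 2 = 4 * p - A ^+ 2).
Local Notation solves := (solves p A h).
Local Notation K := (jac1 A h).

Lemma solves_conj a b d : solves a b d -> solves a^* d^* b^*.
Proof.
case=> h1 h2 h3 h4; split.
- by rewrite conjCK -[RHS]h1; ring.
- by rewrite !conjCK -[RHS]h2; ring.
- by rewrite !conjCK -[RHS]h3; ring.
- by rewrite !conjCK -[RHS]h4; ring.
Qed.

Lemma solves_same_a a b d b' d' : solves a b d -> solves a b' d' ->
  exists k : 'I_3, d' = zeta R ^+ k * d /\ b' = (zeta R ^+ k)^* * b.
Proof.
move=> sol sol'.
have q0 := solves_q_neq0 p4 sol; have q0' := solves_q_neq0 p4 sol'.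
have y0 := solves_Im_neq0 p4 h0 sol.
have qE := solves_qE sol; have qE' := solves_qE sol'.
have dE := solves_dE sol; have dE' := solves_dE sol'.
have bE := solves_bE sol; have bE' := solves_bE sol'.
have D0 : a^* - a != 0.
  apply/negP; rewrite subr_eq0; case: (a) y0 => x y /= y0.
  rewrite eq_complex /= eqxx /= -subr_eq0 -opprD oppr_eq0 -mulr2n mulrn_eq0 /=.
  by rewrite (negbTE y0).
move: q0 q0' qE qE' dE dE' bE bE'.
set W := (_ * _ - 1) * _; set Y := (4 * _)%:C.
move: (b * d^*) (b' * d'^*) => q q' q0 q0' qE qE' dE dE' bE bE'.
have Y0 : Y != 0.
  by apply/eqP => -[/eqP]; rewrite mulf_eq0 pnatr_eq0 /= expf_eq0 (negbTE y0).
have YC : Y^* = Y by rewrite /Y conj_real.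
have W0 : W != 0.
  apply: contra_neq Y0 => W0; move/eqP: qE; rewrite W0 mulr0 mulf_eq0 conjC_eq0.
  by rewrite (negbTE q0) orbF => /eqP.
have nrm z : z != 0 -> Y * z^* = z ^+ 2 * W -> Y ^+ 2 = z * z^* * (W * W^*).
  move=> z0 zE; have zz : z * z^* != 0 by rewrite mulf_neq0 ?conjC_eq0.
  apply: (mulIf zz); transitivity ((Y * z^*) * (Y * z^*)^*).
    by rewrite conjM conjCK YC; ring.
  by rewrite zE conjM conjX; ring.
have qq : q' * q'^* = q * q^*.
  have WW : W * W^* != 0 by rewrite mulf_neq0 ?conjC_eq0.
  by apply: (mulIf WW); rewrite -!nrm.
have q3 : q' ^+ 3 = q ^+ 3.
  apply: (mulIf W0).
  transitivity (q' * (q' ^+ 2 * W)); first by ring.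
  rewrite -qE' mulrCA qq mulrCA qE; ring.
have [k kE] : exists k : 'I_3, q' / q = zeta R ^+ k.
  by apply: cube_eq1; rewrite expr_div_n q3 divff // expf_neq0.
have {}kE : q' = zeta R ^+ k * q by rewrite -kE divfK.
exists k; split.
  by apply: (mulIf D0); rewrite dE' kE -mulrA -dE mulrA.
apply: (can_inj (@conjCK _)); rewrite conjM conjCK.
by apply: (mulIf D0); rewrite bE' kE -mulrA -bE mulrA.
Qed.

Lemma solves_same_Re a b d a' b' d' : solves a b d -> solves a' b' d' ->
  Re a = Re a' -> a = a' \/ a = a'^*.
Proof.
move=> sol sol'; have := etrans (solves_real sol') (esym (solves_real sol)).
have p1 : p - 1 != 0 by rewrite gt_eqF // subr_gt0; have := p4; lra.
case: (a) (a') => [x y] [x' y'] /= e xx.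
have {e} : (p - 1) * (x' ^+ 2 + y' ^+ 2) = (p - 1) * (x' ^+ 2 + y ^+ 2).
  by move: e; rewrite xx => /addrI.
move=> /(mulfI p1)/addrI yy; rewrite xx.
move/eqP: yy; rewrite eqf_sqr => /orP[] /eqP yy; [left|right].
  by rewrite yy.
by apply: complexP; rewrite //= yy opprK.
Qed.

Lemma solves_Re_cases u v a b d :
  0 < u -> u ^+ 2 = p -> 0 <= v -> v ^+ 2 = p + 4 * A + 16 -> 4 < u + v ->
  solves a b d ->
  2 * (p ^+ 2 - 3 * p - A) * Re a = p * A - 2 * p - 2 * A \/
  2 * Re a * (p + 2) + p - 4 = u * v * (1 - 2 * Re a) :> R.
Proof.
move=> u0 uE v0 vE uv sol.
have hr := solves_real sol.
have hc := solves_cubic p4 h0 hE sol.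
have y0 := solves_Im_neq0 p4 h0 sol.
have p1 : p != 1 by apply/eqP => pp; have := p4; rewrite pp; lra.
have := real_part_factor p1 hr hc.
move/eqP; rewrite mulf_eq0 => /orP[/eqP hx|/eqP hx].
  by left; apply/eqP; rewrite -subr_eq0 hx.
right; apply: (real_part_branch _ u0 uE v0 vE uv hr y0 hx).
by apply: lt_trans p4; rewrite ltr1n.
Qed.

End SystemSolutions.

(** * Trigonometric triples in the coordinates of the system *)

Definition cubic_comb (R : realType) (a b d : R[i]) (k : nat) : R[i] :=
  a + b * zeta R ^+ k + d * (zeta R ^+ k)^*.

Section TrigTriple.
Context (R : realType) (t : R).
Local Notation eps := (cos t +i* sin t).

(* [be cos s + ga sin s = b z^j + d z^-j] for the angle [s = t - 2 pi j / 3]. *)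
Definition coord_b (be ga : R[i]) := (be + (0 +i* 1) * ga) / 2 * eps^*.
Definition coord_d (be ga : R[i]) := (be - (0 +i* 1) * ga) / 2 * eps.

Lemma half_re (z : R[i]) : z / 2 = (Re z / 2) +i* (Im z / 2).
Proof.
apply: (mulIf (_ : 2 != 0 :> R[i])); first by rewrite pnatr_eq0.
rewrite divfK ?pnatr_eq0 // -[2 : R[i]]/((1 + 1) +i* (0 + 0)).
by apply: complexP => /=; field.
Qed.

Lemma triple_ofE al be ga (j : 'I_3) :
  triple_of t al be ga j = cubic_comb al (coord_b be ga) (coord_d be ga) j.
Proof.
rewrite /triple_of /cubic_comb /zeta /omega expi_exp.
have -> : 2 * pi / 3 * j%:R = (2 * pi / 3) *+ j :> R by rewrite mulr_natr.
rewrite cosB sinB -!addrA; congr (_ + _).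
move: ((2 * pi / 3) *+ j) => s; rewrite /coord_b /coord_d !half_re.
by case: be ga => [b1 b2] [c1 c2]; apply: complexP => /=; field.
Qed.

(** With a factor [eps] taken out, the third equation contains the angle only through [eps ^+ 3],
    whose value is prescribed; so polynomial equations in the coordinates suffice. [G] and [H] are
    [beta + i gamma] and [beta - i gamma]. *)
Lemma trig_solves p A h u x1 x2 b1 b2 c1 c2 :
  u != 0 -> (eps ^+ 3)^* = (A / (2 * u)) -i* (h / (2 * u)) ->
  [/\ 2 * x1 + (p - 1) * (x1 ^+ 2 + x2 ^+ 2) = 1,
      2 * (x1 ^+ 2 + x2 ^+ 2) + (b1 ^+ 2 + b2 ^+ 2 + c1 ^+ 2 + c2 ^+ 2) = 2,
      4 * (x1 * b1 + x2 * b2) * (2 * u) + (b1 ^+ 2 + b2 ^+ 2 - c1 ^+ 2 - c2 ^+ 2) * A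
        + 2 * (b1 * c1 + b2 * c2) * h = 0
    & - 4 * (x1 * c1 + x2 * c2) * (2 * u) + 2 * (b1 * c1 + b2 * c2) * A
        - (b1 ^+ 2 + b2 ^+ 2 - c1 ^+ 2 - c2 ^+ 2) * h = 0] /\
  (b1 = (1 + A / 2) * (x1 * b1 + x2 * b2) - h / 2 * (x1 * c1 + x2 * c2) /\
   c1 = (1 + A / 2) * (x1 * c1 + x2 * c2) + h / 2 * (x1 * b1 + x2 * b2)) ->
  solves p A h (x1 +i* x2) (coord_b (b1 +i* b2) (c1 +i* c2))
               (coord_d (b1 +i* b2) (c1 +i* c2)).
Proof.
move=> u0 e3 [[h1 h2 h3 h4] [h5 h6]].
have ee : eps * eps^* = 1 by rewrite norm1_conj // expi_norm.
set G := (b1 - c2) +i* (b2 + c1); set H := (b1 + c2) +i* (b2 - c1).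
set X := x1 * b1 + x2 * b2 in h3 h5 h6 *; set Y := x1 * c1 + x2 * c2 in h4 h5 h6 *.
have bE : coord_b (b1 +i* b2) (c1 +i* c2) = G / 2 * eps^*.
  by congr (_ / _ * _); apply: complexP; rewrite /=; ring.
have dE : coord_d (b1 +i* b2) (c1 +i* c2) = H / 2 * eps.
  by congr (_ / _ * _); apply: complexP; rewrite /=; ring.
have half_conj (z : R[i]) : (z / 2)^* = z^* / 2.
  by rewrite !half_re; case: z => x y; apply: complexP => /=; ring.
rewrite bE dE; set a := x1 +i* x2.
have mid : a * (G / 2 * eps^*)^* + H / 2 * eps * a^* = eps * (X +i* (- Y)).
  have -> : X +i* (- Y) = (a * G^* + a^* * H) / 2.
    by rewrite half_re; apply: complexP; rewrite /= /X /Y; field.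
  by rewrite conjM conjCK half_conj; ring.
have bd : G / 2 * eps^* * (H / 2 * eps)^* = G / 2 * (H / 2)^* * (eps^* ^+ 2).
  by rewrite conjM; ring.
have iii : a * (G / 2 * eps^*)^* + H / 2 * eps * a^* + G / 2 * eps^* * (H / 2 * eps)^* = 0.
  rewrite mid bd.
  transitivity (eps * ((X +i* (- Y)) + G / 2 * (H / 2)^* * (eps ^+ 3)^*)).
    by rewrite conjX mulrDr; congr (_ + _); ring : ee.
  rewrite e3 !half_re; have -> : X +i* (- Y) + (Re G / 2 +i* (Im G / 2)) * (Re H / 2 +i* (Im H / 2))^* *
     ((A / (2 * u)) -i* (h / (2 * u))) = 0; last by rewrite mulr0.
  have u4 : 8 * u != 0 by rewrite mulf_neq0 ?pnatr_eq0.
  apply: complexP; apply: (mulfI u4); rewrite /= mulr0.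
    by rewrite -[RHS]h3; field.
  by rewrite -[RHS]h4; field.
split.
- apply: complexP; rewrite /=; last by ring.
  by rewrite -[RHS]h1; ring.
- transitivity (a * a^* + (G / 2 * (G / 2)^* + H / 2 * (H / 2)^*) * (eps * eps^*)).
    by rewrite !conjM conjCK; ring.
  rewrite ee mulr1 !half_re; apply: complexP; rewrite /=; last by ring.
  by have := h2; rewrite /G /H /=; nra.
- exact: iii.
(* The third equation trades [b d^*], which carries [eps^* ^+ 2], for a multiple of [eps], so that
   the whole fourth equation is a multiple of [eps]. *)
- have -> : G / 2 * eps^* * (H / 2 * eps)^* = - (eps * (X +i* (- Y))).
    by apply/eqP; rewrite -addr_eq0 -mid addrC; apply/eqP.
  transitivity (eps * (b1 +i* (- c1) - jac1 A h * (X +i* (- Y)))).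
    have -> : b1 +i* (- c1) = (G^* + H) / 2.
      by rewrite half_re; apply: complexP; rewrite /=; field.
    by rewrite conjM conjCK half_conj; ring.
  have <- : b1 +i* (- c1) = jac1 A h * (X +i* (- Y)); last by rewrite subrr mulr0.
  by apply: complexP; rewrite /= ?[in LHS]h5 ?[in LHS]h6; ring.
Qed.

End TrigTriple.

(** * The canonical triples satisfy the system *)

Section CanonicalSolves.
Context (R : realType) (p : nat) (A B : int).
Hypotheses (p5 : (4 < p)%N) (AB_eq : 4 * p%:Z = A ^+ 2 + 27 * B ^+ 2) (B_gt0 : 0 < B).
Local Notation P := (p%:R : R).
Local Notation a := (A%:~R : R).
Local Notation b := (B%:~R : R).
Let h : R := 3 * Num.sqrt 3 * b.
Let u : R := Num.sqrt P.
Let v : R := Num.sqrt (P + 4 * a + 16).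
Let E : R := u ^+ 2 + u * v + 2.

Lemma gt0_3sqrt3B : 0 < h.
Proof. by rewrite !mulr_gt0 ?sqrtr_gt0 ?ltr0n ?ltr0z. Qed.

Lemma sqr_3sqrt3B : h ^+ 2 = 4 * P - a ^+ 2.
Proof.
have : (4 * p%:Z)%:~R = (A ^+ 2 + 27 * B ^+ 2)%:~R :> R by rewrite AB_eq.
rewrite !(rmorphM, rmorphD, rmorphXn) /= => e.
rewrite /h 2!exprMn sqr_sqrtr ?ler0n //.
have -> : 4 * P = 4%:~R * p%:~R by [].
rewrite e; ring.
Qed.

Lemma p_real_gt4 : 4 < P.
Proof. by rewrite ltr_nat. Qed.

Lemma sqrt_p_gt0 : 0 < u.
Proof. by rewrite sqrtr_gt0 ltr0n (ltn_trans _ p5). Qed.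

Lemma sqr_sqrt_p : u ^+ 2 = P.
Proof. by rewrite sqr_sqrtr ?ler0n. Qed.

Lemma sqrt_p_gt2 : 2 < u.
Proof.
rewrite -(@ltr_pXn2r _ 2) ?nnegrE ?ler0n ?(ltW sqrt_p_gt0) // sqr_sqrt_p.
by apply: le_lt_trans p_real_gt4; rewrite -natrX ler_nat.
Qed.

Lemma A_bound : - (2 * u) < a < 2 * u.
Proof.
rewrite -ltr_norml -(@ltr_pXn2r _ 2) ?nnegrE ?normr_ge0 ?mulr_ge0 ?(ltW sqrt_p_gt0) //.
rewrite -normrX ger0_norm ?sqr_ge0 // exprMn sqr_sqrt_p -natrX -subr_gt0 -sqr_3sqrt3B.
by rewrite exprn_gt0 ?gt0_3sqrt3B.
Qed.

Lemma sqr_v : v ^+ 2 = P + 4 * a + 16.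
Proof.
rewrite sqr_sqrtr //.
have /andP[h1 h2] := A_bound; rewrite -sqr_sqrt_p.
have : 0 <= (u - 4) ^+ 2 by exact: sqr_ge0.
by rewrite sqrrB; nra.
Qed.

Lemma v_ge0 : 0 <= v. Proof. exact: sqrtr_ge0. Qed.

(** As [|A| < 2 u], the square [u ^+ 2 + 4 A + 16] of [v] lies strictly between [(u - 4) ^+ 2] and
    [(u + 4) ^+ 2]. This makes the four radicands in the second canonical solution positive. *)
Lemma v_bound : (u - v < 4) * (v - u < 4) * (4 < u + v).
Proof.
have /andP[h1 h2] := A_bound; have u2 := sqrt_p_gt2.
have v0 := v_ge0; have vv := sqr_v; rewrite -sqr_sqrt_p in vv.
have h3 : v < u + 4.
  by rewrite -(@ltr_pXn2r _ 2) ?nnegrE // ?vv ?sqrrD; nra.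
have h4 : `|u - 4| < v.
  rewrite -(@ltr_pXn2r _ 2) ?nnegrE // vv -normrX ger0_norm ?sqr_ge0 // sqrrB; nra.
by move: h4; rewrite ltr_norml => /andP[h4 h5]; split; [split|]; lra.
Qed.

Let D : R := P ^+ 2 - 3 * P - a.

Lemma canonical1_den_gt0 : 0 < D.
Proof.
have /andP[_ h1] := A_bound; have u2 := sqrt_p_gt2; have p4 := p_real_gt4.
have : 2 * u < P by rewrite -sqr_sqrt_p expr2 ltr_pM2r ?sqrt_p_gt0.
have : 0 < P * (P - 4) by rewrite mulr_gt0 ?subr_gt0 //; lra.
by rewrite /D; lra.
Qed.

Lemma canonical2_den_gt0 : 0 < E.
Proof.
rewrite /E ltr_wpDl ?ltr0n // addr_ge0 ?sqr_ge0 //.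
by rewrite mulr_ge0 ?v_ge0 // ltW ?sqrt_p_gt0.
Qed.

(** The tripled angle is the arccosine in [theta]; its sine is the nonnegative root, and this is
    [h / (2 * u)] because [B > 0]. *)
Lemma eps3_conj : let t := theta R p A in
  ((cos t +i* sin t) ^+ 3)^* = (a / (2 * u)) -i* (h / (2 * u)).
Proof.
have tE : theta R p A *+ 3 = acos (a / (2 * u)).
  by rewrite /theta -mulrnAl -[X in X * _]mulr_natr mulVf ?pnatr_eq0 // mul1r.
move=> t; rewrite expi_exp /t tE.
have u2 : 0 < 2 * u by rewrite mulr_gt0 ?sqrt_p_gt0 ?ltr0n.
have bnd : -1 <= a / (2 * u) <= 1.
  have /andP[h1 h2] := A_bound.
  by rewrite ler_pdivlMr // ler_pdivrMr // mulN1r mul1r !ltW.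
rewrite acosK ?in_itv //= sin_acos //.
congr (_ -i* _).
have -> : 1 - (a / (2 * u)) ^+ 2 = (h / (2 * u)) ^+ 2.
  rewrite !expr_div_n sqr_3sqrt3B exprMn sqr_sqrt_p; field.
  by rewrite -sqr_sqrt_p expf_neq0 ?lt0r_neq0 ?sqrt_p_gt0.
by rewrite sqrtr_sqr ger0_norm // divr_ge0 ?ltW ?gt0_3sqrt3B.
Qed.

Lemma canonical1_solves : exists al be de, [/\ solves P a h al be de,
  2 * D * Re al = P * a - 2 * P - 2 * a &
  forall j, canonical1 R p A B j = cubic_comb al be de j].
Proof.
have D0 := lt0r_neq0 canonical1_den_gt0.
have u0 := lt0r_neq0 sqrt_p_gt0.
have r2 : Num.sqrt (P - 4) ^+ 2 = u ^+ 2 - 4.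
  by rewrite sqr_sqrtr ?subr_ge0 ?sqr_sqrt_p // ltW ?p_real_gt4.
have h2 : h ^+ 2 = 4 * u ^+ 2 - a ^+ 2 by rewrite sqr_3sqrt3B sqr_sqrt_p.
pose N := P * a - 2 * P - 2 * a.
set r := Num.sqrt (P - 4) in r2.
have key := trig_solves u0 eps3_conj (canonical1_real D0 (esym sqr_sqrt_p) r2 h2
  (erefl (N / (2 * D))) (erefl (u * r * h / (2 * D)))
  (erefl (- (u * (P - 4) * (a + 2)) / (2 * D)))
  (erefl (- (r * (P - 2) * h) / (2 * D)))
  (erefl (- (u * (P - 4) * h) / (2 * D))) (erefl (r * N / (2 * D)))).
do 3 eexists; split; first exact: key.
  by rewrite /= mulrCA divff ?mulr1 // mulf_neq0 ?pnatr_eq0.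
move=> j; rewrite -triple_ofE /canonical1 -/u -/r -/D.
by congr (triple_of _ (_ +i* _) (_ +i* _) (_ +i* _) _); rewrite /h /N; field.
Qed.

Lemma canonical2_solves : exists al be de, [/\ solves P a h al be de,
  2 * Re al * (P + 2) + P - 4 = u * v * (1 - 2 * Re al) :> R &
  forall j, canonical2 R p A B j = cubic_comb al be de j].
Proof.
have E0 := lt0r_neq0 canonical2_den_gt0.
have u0 := lt0r_neq0 sqrt_p_gt0.
have [[uv1 uv2] uv3] := v_bound.
have v2 : v ^+ 2 = u ^+ 2 + 4 * a + 16 by rewrite sqr_sqrt_p sqr_v.
pose w := Num.sqrt (4 + u - v) * Num.sqrt (4 - u + v).
pose z := Num.sqrt (u + v + 4) * Num.sqrt (u + v - 4).
have s1 : 0 < 4 + u - v by lra.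
have s2 : 0 < 4 - u + v by lra.
have s3 : 0 < u + v + 4 by lra.
have s4 : 0 < u + v - 4 by lra.
have w2 : w ^+ 2 = 16 - (u - v) ^+ 2 by rewrite exprMn !sqr_sqrtr ?ltW //; ring.
have z2 : z ^+ 2 = (u + v) ^+ 2 - 16 by rewrite exprMn !sqr_sqrtr ?ltW //; ring.
(* Both sides are nonnegative, and their squares agree by [(16 - (u - v)^2) ((u + v)^2 - 16) = 16 (4
   p - A^2)]. *)
have wz : w * z = 4 * h.
  have w0 : 0 <= w by rewrite mulr_ge0 ?sqrtr_ge0.
  have z0 : 0 <= z by rewrite mulr_ge0 ?sqrtr_ge0.
  have h0 := ltW gt0_3sqrt3B.
  apply/eqP; rewrite -(@eqrXn2 _ 2) ?[0 <= w * z]mulr_ge0 ?[0 <= 4 * h]mulr_ge0 //.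
  rewrite [(w * z) ^+ 2]exprMn w2 z2 [(4 * h) ^+ 2]exprMn sqr_3sqrt3B -sqr_sqrt_p; apply/eqP.
  have aE : a = (v ^+ 2 - u ^+ 2 - 16) / 4 by rewrite v2; field.
  by rewrite aE; field.
have key := trig_solves u0 eps3_conj (canonical2_real E0 (esym sqr_sqrt_p) v2 w2 z2 wz
  (erefl (- (u ^+ 2 - u * v - 4) / (2 * E))) (erefl (u * w / (2 * E)))
  (erefl ((a + 2) * u / E)) (erefl ((u ^+ 2 + u * v + 4) * w / (4 * E)))
  (erefl (h * u / E)) (erefl ((u ^+ 2 - u * v - 4) * z / (4 * E)))).
do 3 eexists; split; first exact: key.
  by rewrite /= -sqr_sqrt_p; move: E0; rewrite /E => E0; field.
move=> j; rewrite -triple_ofE /canonical2 -/u -/v -/w -/z -/E.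
by congr (triple_of _ (_ +i* _) (_ +i* _) (_ +i* _) _); rewrite /h; field.
Qed.

(** Eliminating [x] gives [(p - A) u v = p (p - 8 + A)]. Squaring removes the roots and leaves
    [4 p (4 p - A^2) (2 p - A - 4) = 0], where every factor is positive. *)
Lemma Re_distinct x : 2 * D * x = P * a - 2 * P - 2 * a ->
  2 * x * (P + 2) + P - 4 = u * v * (1 - 2 * x) -> False.
Proof.
move=> e1 e2; have p4 := p_real_gt4; have u2 := sqrt_p_gt2; have /andP[_ ha] := A_bound.
have uP : 2 * u < P by rewrite -sqr_sqrt_p expr2 ltr_pM2r ?sqrt_p_gt0.
have p1 : P - 1 != 0 by rewrite lt0r_neq0 // subr_gt0; lra.
have e3 : 2 * D = (P - a) * (P + 2 + u * v).
  apply: (mulfI p1).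
  transitivity (D * ((1 - 2 * x) * (P + 2 + u * v))).
    have -> : (1 - 2 * x) * (P + 2 + u * v) = 2 * (P - 1) by lra.
    by ring.
  have e4 : D * (1 - 2 * x) = (P - 1) * (P - a) by rewrite /D in e1 *; lra.
  by rewrite mulrA e4 mulrA.
have e5 : (P - a) * (u * v) = P * (P - 8 + a) by rewrite /D in e3; lra.
have e6 : P * (4 * (4 * P - a ^+ 2) * (2 * P - a - 4)) = 0.
  transitivity (((P - a) * (u * v)) ^+ 2 - (P * (P - 8 + a)) ^+ 2).
    by rewrite [((P - a) * _) ^+ 2]exprMn [(u * v) ^+ 2]exprMn sqr_v sqr_sqrt_p; ring.
  by rewrite e5 subrr.
have : 0 < P * (4 * (4 * P - a ^+ 2) * (2 * P - a - 4)).
  rewrite -sqr_3sqrt3B; have h2 : 0 < h ^+ 2 by rewrite exprn_gt0 ?gt0_3sqrt3B.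
  have a4 : 0 < 2 * P - a - 4 by lra.
  have P0 : 0 < P by lra.
  by rewrite (mulr_gt0 P0) // (mulr_gt0 _ a4) // mulr_gt0.
by rewrite e6 ltxx.
Qed.

End CanonicalSolves.

Lemma p_ge7 p : prime p -> (p = 1 %[mod 6])%N -> (7 <= p)%N.
Proof. by move=> /prime_gt1 p1 p6; lia. Qed.

Lemma dvd3_p1 p : prime p -> (p = 1 %[mod 6])%N -> (3 %| p - 1)%N.
Proof. by move=> /prime_gt1 p1 p6; lia. Qed.

(** * The cubic character and its Jacobi sum *)

Section CubicCharacter.
Context (R : realType) (p : nat) (g : {unit 'F_p}).
Hypotheses (p_prime : prime p) (p_mod6 : (p = 1 %[mod 6])%N)
  (g_gen : generator [set: {unit 'F_p}]%SET g).

Lemma order_g : #[g]%g = (p - 1)%N.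
Proof.
move: g_gen; rewrite /generator orderE => /eqP <-.
by rewrite card_finField_unit card_Fp // subn1.
Qed.

Lemma unit_pow (j : 'F_p) : j != 0 -> exists n, j = FinRing.uval (g ^+ n)%g.
Proof.
rewrite -unitfE => ju; move: g_gen; rewrite /generator => /eqP gE.
have /cycleP [n nE] : FinRing.Unit ju \in <[g]>%g by rewrite -gE inE.
by exists n; rewrite -nE.
Qed.

Lemma uval_pow_neq0 n : FinRing.uval (g ^+ n)%g != 0 :> 'F_p.
Proof. by rewrite -unitfE; exact: (valP (g ^+ n)%g). Qed.

Lemma mem_cubic_coset_pow n (k : 'I_3) :
  (FinRing.uval (g ^+ n)%g \in cubic_coset g k) = (n %% 3 == k)%N.
Proof.
have h3 := dvd3_p1 p_prime p_mod6; have p7 := p_ge7 p_prime p_mod6.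
apply/imsetP/eqP => [[m _ /val_inj/eqP]|nk].
  rewrite eq_expg_mod_order order_g => /eqP e.
  have : (n %% (p - 1) %% 3 = (k + 3 * m) %% (p - 1) %% 3)%N by rewrite e.
  rewrite !modn_dvdm // => ->.
  by rewrite mulnC addnC modnMDl modn_small.
have lt : ((n %% (p - 1)) %/ 3 < (p - 1) %/ 3)%N.
  by rewrite ltn_divLR // divnK // ltn_pmod //; lia.
exists (Ordinal lt) => //=; congr FinRing.uval; apply/eqP.
rewrite eq_expg_mod_order order_g; apply/eqP.
have -> : (k + 3 * (n %% (p - 1) %/ 3) = n %% (p - 1))%N.
  rewrite {2}(divn_eq (n %% (p - 1)) 3) mulnC addnC; congr (_ + _)%N.
  by rewrite modn_dvdm.
by rewrite modn_mod.
Qed.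

(** The discrete logarithm modulo [3], valued in the additive group ['I_3] so that it is a
    homomorphism on nonzero residues. No coset contains [0], where the default value [0] is
    taken. *)
Definition cubic_class (j : 'F_p) : 'I_3 := odflt 0 [pick k | j \in cubic_coset g k].

Lemma cubic_class_pow n : cubic_class (FinRing.uval (g ^+ n)%g) = inZp n.
Proof.
rewrite /cubic_class; case: pickP => [k|/(_ (inZp n))] /=;
  rewrite mem_cubic_coset_pow /=; last by rewrite eqxx.
by move=> /eqP e; apply: val_inj.
Qed.

Lemma mem_cubic_coset j k : j != 0 -> (j \in cubic_coset g k) = (cubic_class j == k).
Proof.
move=> /unit_pow [n ->]; rewrite mem_cubic_coset_pow cubic_class_pow.
by rewrite -val_eqE.
Qed.

Lemma cubic_coset_neq0 j k : j \in cubic_coset g k -> j != 0.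
Proof. by case/imsetP => m _ ->; apply: uval_pow_neq0. Qed.

Lemma cubic_classM i j : i != 0 -> j != 0 ->
  cubic_class (i * j) = cubic_class i + cubic_class j.
Proof.
move=> /unit_pow [m ->] /unit_pow [n ->].
rewrite -[_ * _]/(FinRing.uval (g ^+ m * g ^+ n)%g) -expgD !cubic_class_pow.
by apply: val_inj; rewrite /= modnDm.
Qed.

Lemma cubic_class1 : cubic_class 1 = 0.
Proof. by rewrite -[1]/(FinRing.uval (g ^+ 0)%g) cubic_class_pow; apply: val_inj. Qed.

Lemma cubic_classg : cubic_class (FinRing.uval g) = 1.
Proof. by rewrite -[g]expg1 cubic_class_pow; apply: val_inj. Qed.

Lemma cubic_classV j : j != 0 -> cubic_class j^-1 = - cubic_class j.
Proof.
move=> j0; apply/eqP; rewrite -addr_eq0 -cubic_classM ?invr_eq0 //.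
by rewrite mulVf // cubic_class1.
Qed.

(** [-1] is its own cube, and the class of a cube is a multiple of [3]. *)
Lemma cubic_classN1 : cubic_class (-1) = 0.
Proof.
have h0 : (-1 : 'F_p) != 0 by rewrite oppr_eq0 oner_eq0.
have : cubic_class ((-1) * ((-1) * (-1))) = cubic_class (-1) by rewrite mulrNN mulr1 mulr1.
rewrite !cubic_classM ?mulf_neq0 //.
by case: (cubic_class (-1)) => -[|[|[|//]]] i /(congr1 val) //= _; apply: val_inj.
Qed.

Lemma cubic_classN j : j != 0 -> cubic_class (- j) = cubic_class j.
Proof.
by move=> j0; rewrite -mulN1r cubic_classM ?oppr_eq0 ?oner_eq0 // cubic_classN1 add0r.
Qed.

Definition chi (j : 'F_p) : R[i] := if j == 0 then 0 else zeta R ^+ cubic_class j.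

Lemma zeta_expD (i k : 'I_3) : zeta R ^+ (i + k)%R = zeta R ^+ i * zeta R ^+ k.
Proof. by rewrite -exprD -(expr_modp (i + k) (zeta3 R)). Qed.

Lemma chi0 : chi 0 = 0. Proof. by rewrite /chi eqxx. Qed.

Lemma chiE j : j != 0 -> chi j = zeta R ^+ cubic_class j.
Proof. by rewrite /chi => /negbTE ->. Qed.

Lemma chiM i j : chi (i * j) = chi i * chi j.
Proof.
have [->|i0] := eqVneq i 0; first by rewrite mul0r chi0 mul0r.
have [->|j0] := eqVneq j 0; first by rewrite mulr0 chi0 mulr0.
by rewrite !chiE ?mulf_neq0 // cubic_classM // zeta_expD.
Qed.

Lemma chi1 : chi 1 = 1. Proof. by rewrite chiE ?oner_eq0 // cubic_class1. Qed.

Lemma chiN j : chi (- j) = chi j.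
Proof. by rewrite -mulN1r chiM chiE ?oppr_eq0 ?oner_eq0 // cubic_classN1 mul1r. Qed.

Lemma chi_norm j : j != 0 -> chi j * (chi j)^* = 1.
Proof. by move=> j0; rewrite chiE // zeta_norm. Qed.

Lemma chi_cube j : j != 0 -> chi j ^+ 3 = 1.
Proof. by move=> j0; rewrite chiE // exprAC zeta3 expr1n. Qed.

Lemma chi_sqr j : chi j ^+ 2 = (chi j)^*.
Proof.
have [->|j0] := eqVneq j 0; first by rewrite chi0 expr0n conjC0.
have c0 : chi j != 0 by rewrite chiE // expf_neq0 // -normr_eq0 expi_norm oner_eq0.
by apply: (mulfI c0); rewrite -exprS chi_cube // chi_norm.
Qed.

Lemma sum_chi : \sum_j chi j = 0.
Proof.
have gu : FinRing.uval g != 0 :> 'F_p by have := uval_pow_neq0 1; rewrite expg1.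
have h : zeta R * \sum_j chi j = \sum_j chi j.
  rewrite mulr_sumr [RHS](reindex_inj (mulfI gu)) /=; apply: eq_bigr => j _.
  by rewrite chiM [chi (FinRing.uval g)]chiE // cubic_classg.
have : (zeta R - 1) * \sum_j chi j = 0 by rewrite mulrBl h mul1r subrr.
by move/eqP; rewrite mulf_eq0 subr_eq0 (negbTE (omega_neq1 R _)) //= => /eqP.
Qed.

Lemma sum_chi_shift m : \sum_j chi (j + m) = 0.
Proof. by rewrite -[RHS]sum_chi [RHS](reindex_inj (addIr m)). Qed.

(** For [m != 0] the terms are [chi (1 + m / j)], and [1 + m / j] runs over all residues except
    [1]. *)
Lemma chi_autocorr m : autocorr chi m = if m == 0 then p%:R - 1 else -1.
Proof.
rewrite /autocorr; have [->|m0] := eqVneq m 0.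
  rewrite (bigD1 0) //= addr0 chi0 mul0r add0r.
  under eq_bigr => j j0 do rewrite addr0 chi_norm //.
  rewrite sumr_const cardC1 card_Fp // -subn1 mulrnBr ?prime_gt0 //.
rewrite (bigD1 0) //= chi0 conjC0 mulr0 add0r.
transitivity (\sum_(j | j != 0) chi (1 + m * j)).
  rewrite [RHS](reindex_inj invr_inj) /=; apply: eq_big => j; first by rewrite invr_eq0.
  move=> j0; have -> : j + m = (1 + m * j^-1) * j by rewrite mulrDl mul1r divfK.
  by rewrite chiM -mulrA chi_norm // mulr1.
have : \sum_j chi (1 + m * j) = 0.
  rewrite -[RHS](sum_chi_shift 1) [RHS](reindex_inj (mulfI m0)) /=.
  by apply: eq_bigr => j _; rewrite addrC.
by rewrite (bigD1 0) //= mulr0 addr0 chi1 => /eqP; rewrite addrC addr_eq0 => /eqP.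
Qed.

(** As [chi] is even, this is the classical Jacobi sum with terms [chi j * chi (1 - j)]. *)
Definition jacobi : R[i] := \sum_j chi (j + 1) * chi j.

Lemma jacobi_shift m : m != 0 -> \sum_j chi (j + m) * chi j = (chi m)^* * jacobi.
Proof.
move=> m0; rewrite (reindex_inj (mulfI m0)) /= mulr_sumr; apply: eq_bigr => j _.
have -> : m * j + m = m * (j + 1) by rewrite mulrDr mulr1.
by rewrite !chiM -chi_sqr; ring.
Qed.

Lemma jacobi_shift0 : \sum_j chi (j + 0) * chi j = 0.
Proof.
under eq_bigr => j _ do rewrite addr0 -expr2 chi_sqr.
by rewrite -conj_sum sum_chi conjC0.
Qed.

(** Both sides sum [f x f y (f z)^* (f w)^*] over the same quadruples, since [x - y = z - w] is
    equivalent to [x - z = y - w]. *)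
Lemma autocorr_energy (f : 'F_p -> R[i]) :
  \sum_m (\sum_j f (j + m) * f j) * (\sum_j f (j + m) * f j)^* =
  \sum_t autocorr f t ^+ 2.
Proof.
transitivity (\sum_m \sum_j \sum_t
   (f (j + t + m) * f (j + t)) * (f (j + m) * f j)^*).
  apply: eq_bigr => m _; rewrite mulrC conj_sum mulr_suml; apply: eq_bigr => j _.
  rewrite mulr_sumr (reindex_inj (addrI j)) /=; apply: eq_bigr => t _.
  by rewrite mulrC.
rewrite exchange_big /=; under eq_bigr => j _ do rewrite exchange_big /=.
rewrite exchange_big /=; apply: eq_bigr => t _.
rewrite expr2 {1}/autocorr mulr_suml; apply: eq_bigr => j _.
rewrite /autocorr mulr_sumr (reindex_inj (addIr (- j))) /=; apply: eq_bigr => k _.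
have -> : j + t + (k - j) = k + t by ring.
have -> : j + (k - j) = k by ring.
by rewrite !conjM; ring.
Qed.

(* Both [sum_m |sum_j chi(j+m) chi(j)|^2 = (p-1) |J|^2] and the energy on the
   other side, [(p-1)^2 + (p-1)], are explicit. *)
Lemma jacobi_norm : jacobi * jacobi^* = p%:R.
Proof.
have p1 : (p%:R - 1 : R[i]) != 0.
  by rewrite subr_eq0 (eqr_nat R[i] p 1) eqn_leq leqNgt prime_gt1.
apply: (mulfI p1).
have := autocorr_energy chi; rewrite (bigD1 0) //= jacobi_shift0 mul0r add0r.
rewrite [RHS](bigD1 0) //= chi_autocorr eqxx.
under eq_bigr => m m0.
  rewrite jacobi_shift // conjM conjCK mulrACA [_ * chi m]mulrC chi_norm // mul1r; over.
under [in RHS]eq_bigr => m m0 do rewrite chi_autocorr (negbTE m0) sqrrN expr1n.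
rewrite !sumr_const cardC1 card_Fp // -subn1 -[LHS]mulr_natl natrB ?prime_gt0 // => ->.
by rewrite mulr1n; ring.
Qed.

End CubicCharacter.

(** * Cyclotomic numbers and the value of the Jacobi sum *)

Lemma big_I3 (T : nmodType) (F : 'I_3 -> T) :
  \sum_(i < 3) F i = F 0 + F 1 + F (-1).
Proof.
rewrite !big_ord_recl big_ord0 addr0 addrA.
by congr (_ + F _ + F _); apply: val_inj.
Qed.

Section JacobiValue.
Context (R : realType) (p : nat) (g : {unit 'F_p}).
Hypotheses (p_prime : prime p) (p_mod6 : (p = 1 %[mod 6])%N)
  (g_gen : generator [set: {unit 'F_p}]%SET g).
Local Notation N := (ncoset g).
Local Notation G := (cubic_coset g).
Local Notation memG := (mem_cubic_coset p_prime p_mod6 g_gen).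

Lemma ncosetE i k : N i k = (\sum_(b : 'F_p) (b \in G i) * ((b + 1)%R \in G k))%N.
Proof.
rewrite /ncoset -sum1_card big_mkcond /=; apply: eq_bigr => b _; rewrite inE.
have [bG|] := boolP (b \in G i); last by rewrite andbF.
by rewrite (cubic_coset_neq0 bG) /= mul1n; case: (_ \in _).
Qed.

Lemma mem0G k : (0 \in G k) = false.
Proof. by apply/negP => /cubic_coset_neq0/eqP. Qed.

Lemma sum_mem_coset (j : 'F_p) : (\sum_k (j \in G k) = (j != 0%R))%N.
Proof.
have [->|j0] := eqVneq j 0.
  by rewrite big1 // => k _; rewrite mem0G.
rewrite (bigD1 (cubic_class g j)) //= memG // eqxx big1 // => k kj.
by rewrite memG // eq_sym (negbTE kj).
Qed.

Lemma card_coset k : #|G k| = ((p - 1) %/ 3)%N.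
Proof.
rewrite card_imset ?card_ord // => m m' /val_inj/eqP.
have h3 := dvd3_p1 p_prime p_mod6.
have lt (n : 'I_((p - 1) %/ 3)) : (k + 3 * n < p - 1)%N.
  have := ltn_ord n; have := ltn_ord k; have := divnK h3; move: (nat_of_ord k) (nat_of_ord n); lia.
rewrite eq_expg_mod_order (order_g p_prime g_gen) !modn_small // eqn_add2l eqn_pmul2l //.
by move/eqP/val_inj.
Qed.

Lemma mem_cosetN j k : (- j \in G k) = (j \in G k).
Proof.
have [->|j0] := eqVneq j 0; first by rewrite oppr0.
by rewrite !memG ?oppr_eq0 // (cubic_classN p_prime p_mod6 g_gen).
Qed.

(** The involution [b |-> - (b + 1)] exchanges [b] and [b + 1] up to sign, and [-1] is a cube. *)
Lemma ncoset_sym i k : N i k = N k i.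
Proof.
rewrite !ncosetE (reindex_inj (can_inj (_ : involutive (fun b : 'F_p => - (b + 1))))) /=.
  apply: eq_bigr => b _; rewrite mem_cosetN mulnC; congr (_ * _)%N.
  by rewrite -mem_cosetN; have -> : - (- (b + 1) + 1) = b by ring.
by move=> b; ring.
Qed.

(** Inversion of [b]: [b^-1 + 1 = (b + 1) / b] lowers the second class by the first. *)
Lemma ncoset_inv i k : N i k = N (- i) (k - i).
Proof.
rewrite !ncosetE (reindex_inj invr_inj) /=; apply: eq_bigr => b _.
have [->|b0] := eqVneq b 0.
  by rewrite invr0 !mem0G.
have [b1|b1] := eqVneq (b + 1) 0.
  have -> : b^-1 + 1 = 0.
    by apply: (mulfI b0); rewrite mulrDr divff // mulr1 addrC b1 mulr0.
  by rewrite b1 !mem0G !muln0.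
have bE : b^-1 + 1 = (b + 1) * b^-1 by rewrite mulrDl mul1r divff // addrC.
have b1' : b^-1 + 1 != 0 by rewrite bE mulf_neq0 ?invr_eq0.
rewrite !memG ?invr_eq0 // bE (cubic_classM p_prime p_mod6 g_gen) ?invr_eq0 //.
rewrite (cubic_classV p_prime p_mod6 g_gen) // -[X in _ = ((X == _) * _)%N]opprK eqr_opp.
have [->|//] := eqVneq (- cubic_class g b) i.
by rewrite -subr_eq opprK.
Qed.

(** Each [b] in [G_i] is counted in the column of [b + 1], except [b = -1], which lies in [G_0]. *)
Lemma ncoset_row i : (\sum_k N i k + (i == 0%R) = (p - 1) %/ 3)%N.
Proof.
rewrite -(card_coset i) -sum1_card [RHS]big_mkcond /=.
under eq_bigr => k _ do rewrite ncosetE.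
rewrite exchange_big /=.
have -> : (i == 0%R : nat) = (\sum_(b : 'F_p) (b \in G i) * ((b + 1)%R == 0%R))%N.
  rewrite (bigD1 (-1)) //= addNr eqxx muln1 big1 ?addn0.
    by rewrite mem_cosetN memG ?oner_eq0 // (cubic_class1 p_prime p_mod6 g_gen) eq_sym.
  by move=> b b1; rewrite addr_eq0 (negbTE b1) muln0.
rewrite -big_split /=; apply: eq_bigr => b _.
rewrite -big_distrr /= sum_mem_coset -mulnDr.
by case: (b + 1 == 0); rewrite /= muln1; case: (_ \in _).
Qed.

Lemma chi_sum (j : 'F_p) : chi R g j = \sum_k (j \in G k)%:R * zeta R ^+ k.
Proof.
have [->|j0] := eqVneq j 0.
  by rewrite chi0 big1 // => k _; rewrite mem0G mul0r.
rewrite chiE // (bigD1 (cubic_class g j)) //= memG // eqxx mul1r big1 ?addr0 // => k kj.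
by rewrite memG // eq_sym (negbTE kj) mul0r.
Qed.

Lemma jacobi_ncoset :
  jacobi R g = \sum_i \sum_k (N i k)%:R * (zeta R ^+ i * zeta R ^+ k).
Proof.
rewrite /jacobi.
under eq_bigr => j _ do rewrite mulrC !chi_sum big_distrlr /=.
rewrite exchange_big /=; apply: eq_bigr => i _.
rewrite exchange_big /=; apply: eq_bigr => k _.
rewrite ncosetE natr_sum mulr_suml; apply: eq_bigr => j _.
by rewrite natrM mulrACA.
Qed.

Lemma zeta_val : zeta R = (- (1 / 2)) +i* (Num.sqrt 3 / 2).
Proof.
have hs := zeta_sum R; rewrite -zeta_conj in hs.
have hn := zeta_norm R 1; rewrite expr1 mul_conj in hn.
have : 0 < Im (zeta R).
  rewrite /= sin_gt0_pi // divr_gt0 ?mulr_gt0 ?pi_gt0 //=.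
  by rewrite ltr_pdivrMr // mulrC ltr_pM2l ?pi_gt0 // ltr_nat.
move: hs hn; case: (zeta R) => x y /(congr1 (@complex.Re R)) /= hx /(congr1 (@complex.Re R)) /= hn y0.
have xE : x = - (1 / 2) by lra.
rewrite xE; congr (_ +i* _); apply/eqP.
rewrite -(@eqrXn2 _ 2) ?divr_ge0 ?sqrtr_ge0 ?(ltW y0) // expr_div_n sqr_sqrtr //.
by apply/eqP; rewrite xE in hn; lra.
Qed.

End JacobiValue.

(* Brahmagupta's identity (with either sign) bounds the multiple of p among
   [A M - B L] and [A M + B L] by [4 p / sqrt 27 < p], so it vanishes. *)
Lemma gauss_form_unique (p : nat) (L M A B : int) : prime p ->
  4 * p%:Z = L ^+ 2 + 27 * M ^+ 2 -> 4 * p%:Z = A ^+ 2 + 27 * B ^+ 2 ->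
  (L = 1 %[mod 3])%Z -> (A = 1 %[mod 3])%Z -> 0 < M -> 0 < B -> L = A /\ M = B.
Proof.
move=> pp eL eA L3 A3 M0 B0.
have p0 : 0 < p%:Z by rewrite ltz_nat prime_gt0.
have small X Y : 16 * p%:Z ^+ 2 = Y ^+ 2 + 27 * X ^+ 2 -> (p%:Z %| X)%Z -> X = 0.
  move=> + /dvdzP[k kE]; rewrite kE => e.
  have : k ^+ 2 < 1.
    have p20 : 0 < p%:Z ^+ 2 by rewrite exprn_gt0.
    rewrite -(ltr_pM2r p20) mul1r -exprMn.
    have : 0 <= Y ^+ 2 by exact: sqr_ge0.
    lia.
  have [->|k0] := eqVneq k 0; first by rewrite mul0r.
  by rewrite ltNge -gtz0_ge1 lt_def sqr_ge0 expf_neq0.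
have prodE : (A * M - B * L) * (A * M + B * L) = 4 * p%:Z * (M ^+ 2 - B ^+ 2).
  have -> : 4 * p%:Z * (M ^+ 2 - B ^+ 2) = 4 * p%:Z * M ^+ 2 - B ^+ 2 * (4 * p%:Z) by ring.
  by rewrite {1}eA eL; ring.
have AMBL : (A * M - B * L) * (A * M + B * L) = 0.
  have : (p%:Z %| (A * M - B * L) * (A * M + B * L))%Z.
    by rewrite prodE dvdz_mulr // dvdz_mull.
  rewrite dvdzE abszM Euclid_dvdM // => /orP[] d.
    rewrite (small (A * M - B * L) (A * L + 27 * B * M)) ?mul0r //.
    have -> : 16 * p%:Z ^+ 2 = (4 * p%:Z) * (4 * p%:Z) by ring.
    by rewrite {1}eA eL; ring.
  rewrite (small (A * M + B * L) (A * L - 27 * B * M)) ?mulr0 //.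
  have -> : 16 * p%:Z ^+ 2 = (4 * p%:Z) * (4 * p%:Z) by ring.
  by rewrite {1}eA eL; ring.
have M2 : M ^+ 2 = B ^+ 2.
  move: AMBL; rewrite prodE => /eqP; rewrite !mulf_eq0 (gt_eqF p0) /= subr_eq0.
  by move=> /eqP.
have MB : M = B.
  by apply/eqP; rewrite -(@eqrXn2 _ 2) ?ltW // M2.
split=> //; have : L ^+ 2 = A ^+ 2 by move: eL; rewrite eA MB => /addIr.
by move/eqP; rewrite eqf_sqr => /orP[] /eqP // LA; lia.
Qed.

Section JacobiEval.
Context (R : realType) (p : nat) (g : {unit 'F_p}) (A B : int).
Hypotheses (p_prime : prime p) (p_mod6 : (p = 1 %[mod 6])%N)
  (g_gen : generator [set: {unit 'F_p}]%SET g)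
  (g_choice : (ncoset g (inord 0) (inord 1) < ncoset g (inord 0) (inord 2))%N)
  (AB_eq : 4 * p%:Z = A ^+ 2 + 27 * B ^+ 2)
  (A_mod3 : (A = 1 %[mod 3])%Z) (B_gt0 : 0 < B).
Local Notation N := (ncoset g).

(** The symmetries reduce the nine [n_ik] to [b], [c], [d] with [n_00 = d - 1], so that
    [J = 3 d - 1 + 3 b zeta + 3 c zeta^2]. Then [g_choice] says that [M = c - b] is positive, the
    shape of [L = 2 Re J] gives its residue modulo [3], and [|J|^2 = p] becomes the quadratic
    form. *)
Lemma jacobiE : jacobi R g = (A%:~R / 2) -i* (3 * Num.sqrt 3 * B%:~R / 2).
Proof.
pose b := N 0 1; pose c := N 0 (-1); pose d := N 1 (-1).
have bc : (b < c)%N.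
  move: g_choice; have -> : inord 0 = 0 :> 'I_3 by apply: val_inj; rewrite /= inordK.
  have -> : inord 1 = 1 :> 'I_3 by apply: val_inj; rewrite /= inordK.
  by have -> : inord 2 = -1 :> 'I_3 by apply: val_inj; rewrite /= inordK.
have n10 : N 1 0 = b by rewrite (ncoset_sym p_prime p_mod6 g_gen).
have n20 : N (-1) 0 = c by rewrite (ncoset_sym p_prime p_mod6 g_gen).
have n21 : N (-1) 1 = d by rewrite (ncoset_sym p_prime p_mod6 g_gen).
have n11 : N 1 1 = c by rewrite (ncoset_inv p_prime p_mod6 g_gen) subrr n20.
have n22 : N (-1) (-1) = b.
  by rewrite (ncoset_inv p_prime p_mod6 g_gen) opprK addNr n10.
have h3 := dvd3_p1 p_prime p_mod6.
have r0 : (N 0%R 0%R + b + c + 1 = (p - 1) %/ 3)%N.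
  by have := ncoset_row p_prime p_mod6 g_gen 0; rewrite big_I3 eqxx.
have r1 : (b + c + d = (p - 1) %/ 3)%N.
  by have := ncoset_row p_prime p_mod6 g_gen 1; rewrite big_I3 n10 n11 /= addn0.
have pE : (p = 3 * (b + c + d) + 1)%N.
  by have := divnK h3; have := prime_gt1 p_prime; rewrite -r1; lia.
have n00 : (N 0%R 0%R + 1 = d)%N by lia.
pose L : int := 6 * d%:Z - 2 - 3 * (b%:Z + c%:Z); pose M : int := c%:Z - b%:Z.
have JE : jacobi R g = (L%:~R / 2) -i* (3 * Num.sqrt 3 * M%:~R / 2).
  rewrite (jacobi_ncoset R p_prime p_mod6 g_gen) !big_I3.
  rewrite n10 n20 n21 n11 n22 -/b -/c -/d.
  have n00' : (N 0 0)%:R = d%:R - 1 :> R[i] by rewrite -n00 natrD addrK.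
  rewrite n00' /=.
  have e1 : (1 %% 3 = 1)%N by [].
  have e2 : ((3 - 1) %% 3 = 2)%N by [].
  rewrite !e1 !e2.
  transitivity (3 * d%:R - 1 + 3 * b%:R * zeta R + 3 * c%:R * zeta R ^+ 2).
    by ring : (zeta3 R).
  have LE : L%:~R = 6 * d%:R - 2 - 3 * (b%:R + c%:R) :> R.
    by rewrite /L !(rmorphB, rmorphD, rmorphM).
  have ME : M%:~R = c%:R - b%:R :> R by rewrite /M rmorphB.
  have nC n : (n%:R : R[i]) = (n%:R)%:C by rewrite rmorph_nat.
  rewrite -zeta_conj zeta_val LE ME (nC 3%N) !nC.
  by apply: complexP => /=; field.
have L3 : (L = 1 %[mod 3])%Z by rewrite /L; lia.
have M0 : 0 < M by rewrite /M; lia.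
move: L M JE L3 M0 => L M JE L3 M0.
have LMR : 4 * p%:R = L%:~R ^+ 2 + 27 * M%:~R ^+ 2 :> R.
  have := jacobi_norm R p_prime p_mod6 g_gen; rewrite JE mul_conj.
  have -> : (p%:R : R[i]) = (p%:R)%:C by rewrite rmorph_nat.
  move=> [] /= <-; have s3 : Num.sqrt 3 ^+ 2 = 3 :> R by rewrite sqr_sqrtr ?ler0n.
  by field : s3.
have LM : 4 * p%:Z = L ^+ 2 + 27 * M ^+ 2.
  by apply/eqP; rewrite -(eqr_int R) !expr2 intrD !intrM -!expr2; apply/eqP.
have [LA MB] := gauss_form_unique p_prime LM AB_eq L3 A_mod3 M0 B_gt0.
by rewrite JE LA MB.
Qed.

End JacobiEval.

(** * Triples as combinations of the characters of Z/3 *)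

Section CubicComb.
Context (R : realType).
Local Notation z := (zeta R).

Lemma cubic_combE (a b d : R[i]) :
  [/\ cubic_comb a b d (0%R : 'I_3) = a + b + d,
      cubic_comb a b d (1%R : 'I_3) = a + b * z + d * z ^+ 2
    & cubic_comb a b d ((-1)%R : 'I_3) = a + b * z ^+ 2 + d * z].
Proof.
have zz : z ^+ 2 * z ^+ 2 = z by rewrite -exprD exprSr zeta3 mul1r.
rewrite /cubic_comb !conjX zeta_conj (_ : nat_of_ord (1%R : 'I_3) = 1%N) //.
by rewrite (_ : nat_of_ord (-1 : 'I_3)%R = 2%N) // [(z ^+ 2) ^+ 2]expr2 zz !expr0 !mulr1 !expr1.
Qed.

(** The witnesses are the discrete Fourier coefficients of [c] on [Z/3]. *)
Lemma cubic_comb_surj (c : 'I_3 -> R[i]) :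
  exists a b d, forall k : 'I_3, c k = cubic_comb a b d k.
Proof.
exists ((c 0 + c 1 + c (-1)) / 3), ((c 0 + c 1 * z ^+ 2 + c (-1) * z) / 3),
  ((c 0 + c 1 * z + c (-1) * z ^+ 2) / 3) => k.
have z2 : z ^+ 2 = - 1 - z.
  by apply/eqP; rewrite -subr_eq0; apply/eqP; rewrite -[RHS](zeta_sum R); ring.
have cases : [\/ k = 0, k = 1 | k = -1].
  by case: k => -[|[|[|//]]] i; [constructor 1|constructor 2|constructor 3]; apply: val_inj.
have [e0 e1 e2] := cubic_combE ((c 0 + c 1 + c (-1)) / 3)
  ((c 0 + c 1 * z ^+ 2 + c (-1) * z) / 3) ((c 0 + c 1 * z + c (-1) * z ^+ 2) / 3).
by case: cases => ->; rewrite ?e0 ?e1 ?e2; field : z2.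
Qed.

Lemma cubic_comb_inj (a b d a' b' d' : R[i]) :
  (forall k : 'I_3, cubic_comb a b d k = cubic_comb a' b' d' k :> R[i]) ->
  [/\ a = a', b = b' & d = d'].
Proof.
have [e0 e1 e2] := cubic_combE a b d; have [e0' e1' e2'] := cubic_combE a' b' d'.
move=> h; have := h (-1); have := h 1; have := h 0.
rewrite e0 e1 e2 e0' e1' e2'; clear h e0 e1 e2 e0' e1' e2'.
have z2 : z ^+ 2 = - 1 - z.
  by apply/eqP; rewrite -subr_eq0; apply/eqP; rewrite -[RHS](zeta_sum R); ring.
have n3 : (3 : R[i]) != 0 by rewrite pnatr_eq0.
move=> h0 h1 h2; split; apply: (mulfI n3).
- transitivity ((a + b + d) + (a + b * z + d * z ^+ 2) + (a + b * z ^+ 2 + d * z)).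
    by ring : z2.
  by rewrite h0 h1 h2; ring : z2.
- transitivity ((a + b + d) + z ^+ 2 * (a + b * z + d * z ^+ 2) + z * (a + b * z ^+ 2 + d * z)).
    by ring : z2.
  by rewrite h0 h1 h2; ring : z2.
- transitivity ((a + b + d) + z * (a + b * z + d * z ^+ 2) + z ^+ 2 * (a + b * z ^+ 2 + d * z)).
    by ring : z2.
  by rewrite h0 h1 h2; ring : z2.
Qed.

(** The square of [z ^+ k] is its conjugate, so a squared modulus is again such a combination, and
    [cubic_comb_inj] can compare coefficients. *)
Lemma cubic_comb_sqr (a b d : R[i]) (k : nat) :
  let w := a * b^* + d * a^* + b * d^* in
  cubic_comb a b d k * (cubic_comb a b d k)^* =
  cubic_comb (a * a^* + b * b^* + d * d^*) w^* w k.
Proof.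
move=> w; rewrite /cubic_comb /w !(conjD, conjM, conjCK).
have zz : z ^+ k * (z ^+ k)^* = 1 by exact: zeta_norm.
have e1 : z ^+ k * z ^+ k = (z ^+ k)^*.
  by rewrite -exprD addnn -mul2n exprM -zeta_conj conjX.
have e2 : (z ^+ k)^* * (z ^+ k)^* = z ^+ k by rewrite -conjM e1 conjCK.
move: (z ^+ k) (z ^+ k)^* zz e1 e2 => x y zz e1 e2.
have e1' : x ^+ 2 = y by rewrite expr2.
have e2' : y ^+ 2 = x by rewrite expr2.
transitivity (a * a^* + (b * b^* + d * d^*) * (x * y) + a * b^* * y + a * d^* * x + b * a^* * x
   + b * d^* * (x * x) + d * a^* * y + d * b^* * (y * y)); first by ring.
by rewrite zz e1 e2; ring.
Qed.

Lemma cubic_comb_unimodular (a b d : R[i]) :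
  (forall k : 'I_3, `|cubic_comb a b d k| = 1 :> R[i]) <->
  a * a^* + b * b^* + d * d^* = 1 /\ a * b^* + d * a^* + b * d^* = 0.
Proof.
have one (k : 'I_3) : cubic_comb 1 0 0 k = 1 :> R[i].
  by rewrite /cubic_comb !mul0r !addr0.
split=> [h|[h1 h2] k].
  have [-> _ ->] : [/\ a * a^* + b * b^* + d * d^* = 1,
     (a * b^* + d * a^* + b * d^*)^* = 0 & a * b^* + d * a^* + b * d^* = 0].
    by apply: cubic_comb_inj => k; rewrite -cubic_comb_sqr norm1_conj // one.
  by [].
by apply: conj_norm1; rewrite cubic_comb_sqr h1 h2 conjC0 one.
Qed.

End CubicComb.

(** * Simple sequences *)

Section SimpleSequence.
Context (R : realType) (p : nat) (g : {unit 'F_p}).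
Hypotheses (p_prime : prime p) (p_mod6 : (p = 1 %[mod 6])%N)
  (g_gen : generator [set: {unit 'F_p}]%SET g).

Definition simple_seq (c : 'I_3 -> R[i]) (j : 'F_p) : R[i] :=
  if j == 0 then 1 else c (cubic_class g j).

Local Notation chi := (chi R g).

Lemma simple_seq_comb a b d j :
  simple_seq (cubic_comb a b d) j =
  (1 - a) * (j == 0)%:R + (a + b * chi j + d * (chi j)^*).
Proof.
rewrite /simple_seq; have [->|j0] := eqVneq j 0.
  by rewrite chi0 conjC0 !mulr0 !addr0 mulr1 subrK.
by rewrite mulr0 add0r /cubic_comb chiE.
Qed.

(** For [m != 0] the spike [(1 - a) delta_0] never meets itself: it contributes two cross terms with
    [f], both at [m] because [f] is even. The rest is the autocorrelation of [f], where the products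
    [chi (j + m) * chi j] bring in the Jacobi sum. *)
Lemma autocorr_simple a b d m : m != 0 ->
  let w := (1 - a) * b^* + d * (1 - a^*) + b * d^* * jacobi R g in
  autocorr (simple_seq (cubic_comb a b d)) m =
  (a + a^* + (p%:R - 2) * (a * a^*) - b * b^* - d * d^*) + w^* * chi m + w * (chi m)^*.
Proof.
move=> m0 w; set y := simple_seq _.
pose f j := a + b * chi j + d * (chi j)^*.
have yE j : y j = (1 - a) * (j == 0)%:R + f j by exact: simple_seq_comb.
have ff : \sum_j f (j + m) * (f j)^* = p%:R * (a * a^*) - b * b^* - d * d^* +
   (b * d^* * jacobi R g)^* * chi m + b * d^* * jacobi R g * (chi m)^*.
  transitivity (\sum_j (a * a^* + a * b^* * (chi j)^* + a * d^* * chi j +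
     (b * a^* * chi (j + m) + b * b^* * (chi (j + m) * (chi j)^*) + b * d^* * (chi (j + m) * chi j)) +
     (d * a^* * (chi (j + m))^* + d * b^* * (chi (j + m) * chi j)^* +
      d * d^* * (chi (j + m) * (chi j)^*)^*))).
    by apply: eq_bigr => j _; rewrite /f !(conjD, conjM, conjCK); ring.
  rewrite !big_split /= -!mulr_sumr -!conj_sum sum_chi // sum_chi_shift //.
  rewrite (jacobi_shift R p_prime p_mod6 g_gen) // -/(autocorr chi m) chi_autocorr // (negbTE m0).
  rewrite sumr_const card_Fp // -[_ *+ p in LHS]mulr_natl !conjC0 !(conjM, conjCK).
  have -> : (-1)^* = -1 :> R[i] by apply: rmorphN1.
  by ring.
have fN j : f (- j) = f j by rewrite /f chiN.
transitivity ((1 - a) * (f m)^* + f m * (1 - a)^* + \sum_j f (j + m) * (f j)^*).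
  rewrite /autocorr.
  under eq_bigr => j _ do rewrite yE mulrDl.
  rewrite big_split /=; rewrite -addrA; congr (_ + _).
    rewrite (bigD1 (- m)) //= addNr eqxx mulr1 big1 ?addr0.
      by rewrite yE oppr_eq0 (negbTE m0) mulr0 add0r fN.
    by move=> j jm; rewrite addr_eq0 (negbTE jm) mulr0 mul0r.
  under eq_bigr => j _ do rewrite yE conjD mulrDr.
  rewrite big_split /=; congr (_ + _).
  rewrite (bigD1 0) //= add0r ?eqxx mulr1 big1 ?addr0 //.
  by move=> j j0; rewrite (negbTE j0) mulr0 conjC0 mulr0.
by rewrite ff /f /w !(conjB, conjD, conjM, conjCK) conjC1; ring.
Qed.

Lemma cubic_class_surj k : exists2 j : 'F_p, j != 0 & cubic_class g j = k.
Proof.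
exists (FinRing.uval (g ^+ k)%g); first exact: uval_pow_neq0.
by rewrite cubic_class_pow //; apply: val_inj; rewrite /= modn_small.
Qed.

Lemma unimodular_simple c :
  unimodular (simple_seq c) <-> forall k, `|c k| = 1.
Proof.
split=> [h k|h j]; last by rewrite /simple_seq; case: eqP; rewrite ?normr1.
have [j j0 <-] := cubic_class_surj k.
by have := h j; rewrite /simple_seq (negbTE j0).
Qed.

(** The conditions [c0 = 0] and [w = 0] become the first and the fourth equation when the
    unimodularity equations are added to them; adding the third one to [w] is what turns [J] into
    [1 + J]. *)
Lemma bi_unimodular_simple (A B : int)
  (g_choice : (ncoset g (inord 0) (inord 1) < ncoset g (inord 0) (inord 2))%N)
  (AB_eq : 4 * p%:Z = A ^+ 2 + 27 * B ^+ 2)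
  (A_mod3 : (A = 1 %[mod 3])%Z) (B_gt0 : 0 < B) a b d :
  bi_unimodular (simple_seq (cubic_comb a b d)) <->
  solves p%:R A%:~R (3 * Num.sqrt 3 * B%:~R) a b d.
Proof.
have JE : jac1 A%:~R (3 * Num.sqrt 3 * B%:~R) = 1 + jacobi R g.
  rewrite (jacobiE R p_prime p_mod6 g_gen g_choice AB_eq A_mod3 B_gt0).
  by apply: complexP => /=; ring.
have pE : (p%:R - 1 : R)%:C = p%:R - 1 by rewrite realcB rmorph_nat.
rewrite bi_unimodularP // unimodular_simple cubic_comb_unimodular /solves JE pE.
set w := (1 - a) * b^* + d * (1 - a^*) + b * d^* * jacobi R g.
set c0 := a + a^* + (p%:R - 2) * (a * a^*) - b * b^* - d * d^*.
have corr : (forall m, m != 0 -> autocorr (simple_seq (cubic_comb a b d)) m = 0) <->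
    c0 = 0 /\ w = 0.
  split=> [h|[h1 h2] m m0]; last first.
    by rewrite autocorr_simple // -/w -/c0 h1 h2 conjC0 !mul0r !addr0.
  have [-> _ ->] : [/\ c0 = 0, w^* = 0 & w = 0].
    apply: cubic_comb_inj => k; have [j j0 <-] := cubic_class_surj k.
    have := h _ j0; rewrite autocorr_simple // -/w -/c0 chiE // => e.
    by rewrite /cubic_comb e !mul0r !addr0.
  by [].
rewrite corr; split.
  move=> [[h2 h3] [h0 hw]]; split=> //.
    transitivity (c0 + (a * a^* + b * b^* + d * d^*)); first by rewrite /c0; ring.
    by rewrite h0 h2 add0r.
  transitivity (w + (a * b^* + d * a^* + b * d^*)); first by rewrite /w; ring.
  by rewrite hw h3 addr0.
move=> [h1 h2 h3 h4]; split; split=> //.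
  rewrite /c0; apply/eqP; rewrite -subr_eq0; apply/eqP.
  transitivity (a + a^* + (p%:R - 1) * (a * a^*) - (a * a^* + b * b^* + d * d^*)); first by ring.
  by rewrite h1 h2 subrr.
transitivity (b^* + d + (1 + jacobi R g) * (b * d^*) - (a * b^* + d * a^* + b * d^*)).
  by rewrite /w; ring.
by rewrite h3 h4 subrr.
Qed.

End SimpleSequence.

(** * The six symmetries of the system *)

Section Orbit.
Context (R : realType) (p A h : R).
Hypotheses (p4 : 4 < p) (h0 : h != 0) (hE : h ^+ 2 = 4 * p - A ^+ 2).
Local Notation solves := (solves p A h).
Local Notation z := (zeta R).

Lemma zeta_neq0 k : z ^+ k != 0.
Proof. by rewrite expf_neq0 // -normr_eq0 expi_norm oner_eq0. Qed.

Lemma zeta_expN (k : 'I_3) : z ^+ (- k)%R = (z ^+ k)^*.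
Proof.
apply: (mulfI (zeta_neq0 k)); rewrite zeta_norm.
by rewrite -zeta_expD subrr expr0.
Qed.

Lemma zeta_exp_inj (k l : 'I_3) : z ^+ k = z ^+ l -> k = l.
Proof.
move=> e; apply/eqP; rewrite -subr_eq0.
have : z ^+ (k - l)%R = 1 by rewrite zeta_expD zeta_expN e zeta_norm.
have z1 : z <> 1 by apply/eqP/omega_neq1.
case: (k - l) => -[|[|[|//]]] i //= e1.
by case: z1; rewrite -[LHS]mulr1 -e1 -exprS zeta3.
Qed.

Lemma cubic_comb_shift (a b d : R[i]) (k j : 'I_3) :
  cubic_comb a b d (k + j)%R = cubic_comb a (z ^+ k * b) ((z ^+ k)^* * d) j.
Proof. by rewrite /cubic_comb zeta_expD conjM; ring. Qed.

Lemma cubic_comb_conj (a b d : R[i]) (j : nat) :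
  (cubic_comb a b d j)^* = cubic_comb a^* d^* b^* j.
Proof. by rewrite /cubic_comb !(conjD, conjM, conjCK); ring. Qed.

Lemma solves_unimodular a b d (k : 'I_3) : solves a b d -> `|cubic_comb a b d k| = 1.
Proof. by case=> _ h2 h3 _; have [_] := cubic_comb_unimodular a b d; apply. Qed.

Lemma solves_shift a b d k : solves a b d ->
  solves a (z ^+ k * b) ((z ^+ k)^* * d).
Proof.
have zz := zeta_norm R k.
have e1 : z ^+ k * z ^+ k = (z ^+ k)^*.
  by rewrite -exprD addnn -mul2n exprM -zeta_conj conjX.
move: (z ^+ k) zz e1 => w zz e1 [h1 h2 h3 h4]; split=> //; rewrite ?conjM ?conjCK.
- by rewrite -[RHS]h2; ring : zz.
- by rewrite -[RHS](mulr0 w^*) -h3; ring : e1.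
- by rewrite -[RHS](mulr0 w^*) -h4; ring : e1.
Qed.

(** A shift and an inversion flag: a finite index type for the six triples, so that counting reduces
    to injectivity. *)
Definition orbit_triple (c : 'I_3 -> R[i]) (t : 'I_3 * bool) (j : 'I_3) : R[i] :=
  if t.2 then 1 / c (t.1 + j) else c (t.1 + j).

Lemma triple_fromP (c c' : 'I_3 -> R[i]) :
  triple_from c c' <-> exists t, forall j, c' j = orbit_triple c t j.
Proof.
split=> [[k [kE|kE]]|[[k [] kE]]].
- by exists (k, false).
- by exists (k, true).
- by exists k; right.
- by exists k; left.
Qed.

Lemma orbit_tripleF (a b d : R[i]) k j :
  orbit_triple (cubic_comb a b d) (k, false) j = cubic_comb a (z ^+ k * b) ((z ^+ k)^* * d) j.
Proof. exact: cubic_comb_shift. Qed.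

Lemma orbit_tripleT a b d k j : solves a b d ->
  orbit_triple (cubic_comb a b d) (k, true) j =
  cubic_comb a^* ((z ^+ k)^* * d)^* (z ^+ k * b)^* j.
Proof.
move=> sol; rewrite /orbit_triple /= div1r invc_norm1; last exact: (solves_unimodular (k + j) sol).
by rewrite cubic_comb_shift cubic_comb_conj.
Qed.

Lemma orbit_coords a b d t : solves a b d -> exists a' b' d',
  [/\ solves a' b' d', Re a' = Re a
    & forall j, orbit_triple (cubic_comb a b d) t j = cubic_comb a' b' d' j].
Proof.
case: t => k [] sol.
  do 3 eexists; split; last by move=> j; exact: orbit_tripleT.
    exact/solves_conj/solves_shift.
  by case: (a).
do 3 eexists; split; last by move=> j; exact: orbit_tripleF.
  exact: solves_shift.
by [].
Qed.

Lemma conj_neq (a : R[i]) : Im a != 0 -> a^* <> a.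
Proof.
case: a => x y /= y0 [] /eqP; rewrite -subr_eq0 -opprD oppr_eq0 -mulr2n mulrn_eq0 /=.
exact/negP.
Qed.

(** The constant coefficient, [a] or [a^*], reveals the flag because [a] is not real; a nonzero
    coefficient scaled by [zeta ^+ k] reveals the shift. *)
Lemma orbit_triple_inj a b d t t' : solves a b d ->
  (forall j, orbit_triple (cubic_comb a b d) t j = orbit_triple (cubic_comb a b d) t' j) ->
  t = t'.
Proof.
move=> sol e; have aI := conj_neq (solves_Im_neq0 p4 h0 sol).
have := solves_q_neq0 p4 sol; rewrite mulf_eq0 conjC_eq0 negb_or => /andP[b0 d0].
case: t t' e => k [] [k' []] combE.
- have [] := cubic_comb_inj (fun j => etrans (esym (orbit_tripleT k j sol))
    (etrans (combE j) (orbit_tripleT k' j sol))).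
  by move=> _ _ /(can_inj (@conjCK _))/(mulIf b0)/zeta_exp_inj ->.
- have [] := cubic_comb_inj (fun j => etrans (esym (orbit_tripleT k j sol))
    (etrans (combE j) (orbit_tripleF a b d k' j))).
  by move=> /aI.
- have [] := cubic_comb_inj (fun j => etrans (esym (orbit_tripleF a b d k j))
    (etrans (combE j) (orbit_tripleT k' j sol))).
  by move=> /esym/aI.
- have [] := cubic_comb_inj (fun j => etrans (esym (orbit_tripleF a b d k j))
    (etrans (combE j) (orbit_tripleF a b d k' j))).
  by move=> _ /(mulIf b0)/zeta_exp_inj ->.
Qed.

(** [Re a] is thus a complete invariant of solutions up to the six operations, and only real parts
    have to be compared later. *)
Lemma solves_orbit a0 b0 d0 a b d (c c0 : 'I_3 -> R[i]) :
  solves a0 b0 d0 -> solves a b d -> Re a = Re a0 ->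
  (forall j, c0 j = cubic_comb a0 b0 d0 j) -> (forall j, c j = cubic_comb a b d j) ->
  triple_from c0 c.
Proof.
move=> sol0 sol ra c0E cE.
have shift b1 d1 b2 d2 a1 : solves a1 b1 d1 -> solves a1 b2 d2 ->
    exists k : 'I_3, forall j : 'I_3, cubic_comb a1 b2 d2 j = cubic_comb a1 b1 d1 (k + j)%R.
  move=> s1 s2; have [k [-> ->]] := solves_same_a p4 h0 s1 s2.
  exists (- k) => j; rewrite cubic_comb_shift.
  by rewrite zeta_expN conjCK.
have [aE|aE] := solves_same_Re p4 sol sol0 ra.
  rewrite aE in sol cE; have [k kE] := shift _ _ _ _ _ sol0 sol.
  by exists k; left=> j; rewrite cE kE -c0E.
rewrite aE in sol cE; have [k kE] := shift _ _ _ _ _ (solves_conj sol0) sol.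
exists k; right=> j; rewrite cE kE -cubic_comb_conj c0E div1r invc_norm1 //.
exact: (solves_unimodular (k + j) sol0).
Qed.

End Orbit.

(** * Modulations and translations of simple sequences *)

Section Structure.
Context (R : realType) (p : nat) (g : {unit 'F_p}).
Hypotheses (p_prime : prime p) (p_mod6 : (p = 1 %[mod 6])%N)
  (g_gen : generator [set: {unit 'F_p}]%SET g).
Local Notation e := (@omega_pow R p).

Lemma simple_seq0 c : simple_seq (R := R) g c 0 = 1.
Proof. by rewrite /simple_seq eqxx. Qed.

Lemma simple_seqN c j : simple_seq (R := R) g c (- j) = simple_seq g c j.
Proof.
rewrite /simple_seq oppr_eq0; case: eqP => // /eqP j0.
by rewrite (cubic_classN p_prime p_mod6 g_gen).
Qed.

Lemma simple_seq_eq (c c' : 'I_3 -> R[i]) :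
  simple_seq g c =1 simple_seq g c' -> c =1 c'.
Proof.
move=> h k; have [j j0 <-] := cubic_class_surj p_prime p_mod6 g_gen k.
by have := h j; rewrite /simple_seq (negbTE j0).
Qed.

Lemma index3_twist (x : 'F_p -> R[i]) : unimodular x -> index3 g x ->
  exists b r l c, `|b| = 1 /\ x =1 twist b r l (simple_seq g c).
Proof.
move=> ux [r [l [y [[c cE] xE]]]].
have uy j : `|y j| = 1.
  by have := ux (j + l); rewrite xE normrM omega_pow_norm mul1r addrK.
have y0 : y 0 != 0 by rewrite -normr_eq0 uy oner_eq0.
(* Index 3 leaves [y 0] free; dividing by it moves it into the unimodular factor. *)
exists (y 0), r, l, (fun k => c k / y 0); split=> // j.
rewrite xE /twist /simple_seq; case: eqP => [->|/eqP jl]; first by rewrite mulr1 mulrC.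
rewrite (cE (cubic_class g (j - l))) ?(mem_cubic_coset p_prime p_mod6 g_gen) //.
by rewrite mulrAC mulrCA divff // mulr1 mulrC.
Qed.

Lemma twist_index3 (b : R[i]) r l c : index3 g (twist b r l (simple_seq g c)).
Proof.
exists r, l, (fun j => b * simple_seq g c j); split.
  exists (fun k => b * c k) => k j j0.
  by rewrite (mem_cubic_coset p_prime p_mod6 g_gen) // /simple_seq (negbTE j0) => /eqP ->.
by move=> j; rewrite /twist mulrCA mulrA.
Qed.

Lemma has_formP (c : 'I_3 -> R[i]) x : has_form g c x <->
  exists b r l, `|b| = 1 /\ x =1 twist b r l (simple_seq g c).
Proof.
split=> -[b [r [l]]].
  case=> b1 xl xE; exists b, r, l; split=> // j; rewrite /twist /simple_seq.
  case: eqP => [/eqP|/eqP jl]; first by rewrite subr_eq0 => /eqP ->; rewrite mulr1.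
  by apply: xE; rewrite // (mem_cubic_coset p_prime p_mod6 g_gen).
case=> b1 xE; exists b, r, l; split=> //; first by rewrite xE /twist subrr simple_seq0 mulr1.
move=> k j jl; rewrite (mem_cubic_coset p_prime p_mod6 g_gen) // => /eqP <-.
by rewrite xE /twist /simple_seq (negbTE jl).
Qed.

(* Evenness of [y] makes [y'] quasi-periodic with period [2 * l], hence a
   quadratic chirp; such a chirp is constant on the cubic residues only if all
   of them square to 1. *)
Lemma twist_rigid (c c' : 'I_3 -> R[i]) b r l b' r' l' :
  `|b| = 1 -> `|b'| = 1 -> bi_unimodular (simple_seq g c') ->
  twist b r l (simple_seq g c) =1 twist b' r' l' (simple_seq g c') ->
  [/\ r = r', l = l' & c =1 c'] \/
  p = 7%N /\ exists2 m : 'F_p, m != 0 & forall j, simple_seq g c' j = e (m * j ^+ 2).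
Proof.
move=> b1 b1' bi tw.
have p7 := p_ge7 p_prime p_mod6.
have two0 : (2 : 'F_p) != 0.
  rewrite -(dvdn_pcharf (pchar_Fp p_prime)); apply/negP => /dvdn_leq; lia.
set y := simple_seq g c in tw *; set y' := simple_seq g c' in bi tw *.
have b0 : b != 0 by rewrite -normr_eq0 b1 oner_eq0.
have b0' : b' != 0 by rewrite -normr_eq0 b1' oner_eq0.
pose rho := r' - r; pose lam := l' - l.
have [kap [kap0 yE]] : exists kap, kap != 0 /\ forall j, y j = kap * e (rho * j) * y' (j - lam).
  exists (b' / b * e (rho * l)); split.
    by rewrite !mulf_neq0 ?invr_eq0 ?omega_pow_neq0.
  move=> j; have be0 : b * e (r * (j + l)) != 0 by rewrite mulf_neq0 ?omega_pow_neq0.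
  apply: (mulfI be0); have := tw (j + l); rewrite /twist addrK => ->.
  have -> : j + l - l' = j - lam by rewrite /lam; ring.
  have -> : r' * (j + l) = r * (j + l) + (rho * l + rho * j) by rewrite /rho; ring.
  by rewrite !omega_powD //; field.
have y'0 : y' 0 = 1 by exact: simple_seq0.
have [lam0|lam0] := eqVneq lam 0.
  left.
  have kap1 : kap = 1.
    have := yE 0; rewrite lam0 subr0 mulr0 omega_pow0 y'0 !mulr1 => <-.
    exact: simple_seq0.
  have u j : y' j != 0 by rewrite -normr_eq0 (proj1 bi j) oner_eq0.
  (* Both sequences are even, so the values at [1] and [-1] give [e rho = e (- rho)], and [p] is
     odd. *)
  have rho0 : rho = 0.
    have e1 := yE 1; have eN1 := yE (-1).
    rewrite lam0 subr0 kap1 mul1r mulr1 in e1.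
    rewrite lam0 subr0 kap1 mul1r mulrN1 /y /y' !simple_seqN -/y -/y' in eN1.
    have : e rho = e (- rho) by apply: (mulIf (u 1)); rewrite -e1.
    move/(omega_pow_inj p_prime)/eqP; rewrite -subr_eq0 opprK -mulr2n -mulr_natl.
    by rewrite mulf_eq0 (negbTE two0) => /eqP.
  split.
  - by apply/eqP; rewrite eq_sym -subr_eq0 -/rho rho0.
  - by apply/eqP; rewrite eq_sym -subr_eq0 -/lam lam0.
  - apply: simple_seq_eq => j; have := yE j.
    by rewrite lam0 subr0 kap1 rho0 mul0r omega_pow0 !mul1r.
right.
have step j : y' (j + 2 * lam) = e (2 * rho * (j + lam)) * y' j.
  have h1 := yE (j + lam); have h2 := yE (- (j + lam)).
  rewrite addrK in h1.
  have {}h2 : y (j + lam) = kap * e (- (rho * (j + lam))) * y' (j + 2 * lam).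
    rewrite -[y (j + lam)](simple_seqN c) -/y h2 mulrN; congr (_ * _).
    rewrite -[LHS](simple_seqN c') -/y'; congr y'; ring.
  have eN : e (rho * (j + lam)) * e (- (rho * (j + lam))) = 1.
    by rewrite -omega_powD // subrr.
  have ke0 : kap * e (- (rho * (j + lam))) != 0 by rewrite mulf_neq0 ?omega_pow_neq0.
  apply: (mulfI ke0); rewrite -h2 h1.
  have -> : 2 * rho * (j + lam) = rho * (j + lam) + rho * (j + lam) by ring.
  rewrite omega_powD //; ring : eN.
(* Chosen so that [m (j + 2 lam)^2 - m j^2 = 2 rho (j + lam)]. As [2 lam] is nonzero, its multiples
   reach every residue. *)
pose m := rho / (2 * lam).
have l2 : 2 * lam != 0 by rewrite mulf_neq0.
have chirp j : y' j = e (m * j ^+ 2).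
  have iter n : y' ((2 * lam) *+ n) = e (m * ((2 * lam) *+ n) ^+ 2).
    elim: n => [|n IH]; first by rewrite mulr0n y'0 expr0n mulr0.
    rewrite mulrSr step IH -omega_powD //; congr e.
    move: (_ *+ n) => q; rewrite /m; field.
    by rewrite two0 lam0.
  have := iter (j / (2 * lam) : 'F_p); rewrite -[_ *+ _]mulr_natr natr_Zp.
  by rewrite mulrC divfK.
have m0 : m != 0.
  apply/negP => /eqP m0; have /(bi_unimodularP p_prime) [_ hc] := bi.
  have := hc 1 (oner_neq0 _); rewrite /autocorr.
  under eq_bigr => j _ do rewrite !chirp m0 !mul0r omega_pow0 conjC1 mul1r.
  by move/eqP; rewrite sumr_const card_Fp // pnatr_eq0; have := prime_gt0 p_prime; case: (p).
split; last by exists m.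
pose k := FinRing.uval (g ^+ 3)%g : 'F_p.
have k0 : k != 0 by exact: uval_pow_neq0.
have : y' k = y' 1.
  rewrite /y' /simple_seq (negbTE k0) oner_eq0 (cubic_class_pow p_prime p_mod6 g_gen).
  by rewrite (cubic_class1 p_prime p_mod6 g_gen); congr c'; apply: val_inj.
rewrite !chirp => /(omega_pow_inj p_prime)/(mulfI m0); rewrite expr1n => k2.
have : (g ^+ 6 = 1)%g.
  have -> : (g ^+ 6 = g ^+ 3 * g ^+ 3)%g by rewrite -expgD.
  by apply: val_inj; exact: k2.
move/eqP; rewrite -order_dvdn (order_g p_prime g_gen) => /dvdn_leq.
by lia.
Qed.

End Structure.

Lemma card_eq_range (T : finType) (U : Type) (f : T -> U) (S : set U) :
  injective f -> (forall x, S x <-> exists t, f t = x) -> (S #= `I_#|T|)%card.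
Proof.
move=> f_inj SE.
have SfE : S = (f @` [set: T])%classic.
  apply/seteqP; split=> x; first by move/SE => [t <-]; exists t.
  by case=> t _ <-; apply/SE; exists t.
have TE : [set: T]%classic = ((@enum_val T predT) @` [set: 'I_#|T|])%classic.
  by apply/seteqP; split=> // t _; exists (enum_rank t); rewrite ?enum_rankK.
rewrite SfE; apply: card_eq_trans; first by apply: inj_card_eq => x y _ _; exact: f_inj.
rewrite TE; apply: card_eq_trans; first by apply: inj_card_eq => x y _ _; exact: enum_val_inj.
by rewrite card_eq_sym card_II.
Qed.

(** * Quadratic chirps *)

Section Chirp.
Context (R : realType) (p : nat) (p_prime : prime p) (p_odd : (2 < p)%N).
Local Notation e := (@omega_pow R p).

Definition chirp (m n j : 'F_p) : R[i] := e (m * j ^+ 2 + n * j).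

Lemma Fp_two_neq0 : (2 : 'F_p) != 0.
Proof.
by rewrite -(dvdn_pcharf (pchar_Fp p_prime)); apply/negP => /dvdn_leq; have := p_odd; lia.
Qed.

(** The values at [1] and [-1] give [m + n] and [m - n], which suffice as [p] is odd. *)
Lemma chirp_inj m n m' n' : chirp m n =1 chirp m' n' -> (m, n) = (m', n').
Proof.
move=> h; have := h (-1); have := h 1; rewrite /chirp.
rewrite sqrrN !expr1n !mulr1 !mulrN1 => /(omega_pow_inj p_prime) e1 /(omega_pow_inj p_prime) e2.
have nE : n = n'.
  apply: (mulfI Fp_two_neq0).
  transitivity ((m + n) - (m - n)); first by ring.
  by rewrite e1 e2; ring.
by move: e1; rewrite nE => /addIr ->.
Qed.

(** In the autocorrelation at [t] the squares of [j] cancel, leaving a full sum of [e] with the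
    nonzero slope [2 m t]. *)
Lemma chirp_bi_unimodular m : m != 0 -> bi_unimodular (chirp m 0).
Proof.
move=> m0; apply/(bi_unimodularP p_prime); split=> [j|t t0]; first exact: omega_pow_norm.
rewrite /autocorr.
transitivity (e (m * t ^+ 2) * \sum_j e (2 * m * t * j)).
  rewrite mulr_sumr; apply: eq_bigr => j _.
  rewrite /chirp -omega_powN // -!omega_powD //; congr e; ring.
by rewrite sum_omega_pow ?mulr0 // !mulf_neq0 ?Fp_two_neq0.
Qed.

(** Translating a chirp only modulates it, so [r] and [l] matter only through [r - 2 m l]. *)
Lemma twist_chirp b r l m : twist b r l (chirp m 0) 0 = 1 ->
  twist b r l (chirp m 0) =1 chirp m (r - 2 * m * l).
Proof.
rewrite /twist mulr0 omega_pow0 mulr1 => b1 j.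
have -> : chirp m 0 (j - l) = chirp m 0 (0 - l) * e (m * j ^+ 2 - 2 * m * l * j).
  by rewrite /chirp -omega_powD //; congr e; ring.
have -> : chirp m (r - 2 * m * l) j = e (r * j) * e (m * j ^+ 2 - 2 * m * l * j).
  by rewrite /chirp -omega_powD //; congr e; ring.
by rewrite -[RHS]mul1r -b1; ring.
Qed.

Lemma chirp_twist m n : chirp m n =1 twist 1 n 0 (chirp m 0).
Proof. by move=> j; rewrite /twist subr0 mul1r /chirp -omega_powD //; congr e; ring. Qed.

End Chirp.

Lemma big_nat6 (V : nmodType) (F : nat -> V) :
  \sum_(0 <= n < 6) F n = F 0%N + F 1%N + F 2%N + F 3%N + F 4%N + F 5%N.
Proof. by rewrite !big_nat_recr //= big_geq // add0r. Qed.

Section ChirpSeven.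
Context (R : realType) (p : nat) (g : {unit 'F_p}).
Hypotheses (p_prime : prime p) (p_mod6 : (p = 1 %[mod 6])%N)
  (g_gen : generator [set: {unit 'F_p}]%SET g) (p7 : p = 7%N).
Local Notation e := (@omega_pow R p).
Local Notation gv n := (FinRing.uval (g ^+ n)%g : 'F_p).

Definition chirp_triple (m : 'F_p) (k : 'I_3) : R[i] := e (m * gv k ^+ 2).

Lemma order_g7 : #[g]%g = 6%N.
Proof. by rewrite (order_g p_prime g_gen) p7. Qed.

Lemma gv_sqr n : gv n ^+ 2 = gv (2 * n).
Proof. by rewrite mulnC expgM. Qed.

(** [g] has order [6], so squares see exponents only modulo [3]: this makes the chirps simple of
    index 3 when [p = 7]. *)
Lemma gv_sqr_mod n : gv (n %% 3) ^+ 2 = gv n ^+ 2.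
Proof.
rewrite !gv_sqr; congr FinRing.uval; apply/eqP.
by rewrite eq_expg_mod_order order_g7 (_ : 6 = 2 * 3)%N // -!muln_modr modn_mod.
Qed.

Lemma gvD m n : gv (m + n) = gv m * gv n.
Proof. by rewrite expgD. Qed.

Lemma gv3 : gv 3 = -1.
Proof.
have h : gv 3 ^+ 2 = 1.
  have o : (g ^+ 6 = 1)%g by apply/eqP; rewrite -order_dvdn order_g7.
  by rewrite gv_sqr o.
move/eqP: h; rewrite -[X in _ == X](expr1n 'F_p 2) eqf_sqr => /orP[/eqP h|/eqP //].
have : (g ^+ 3 = 1)%g by apply: val_inj.
by move/eqP; rewrite -order_dvdn order_g7.
Qed.

Lemma chirp_simple m : chirp R m 0 =1 simple_seq g (chirp_triple m).
Proof.
move=> j; rewrite /chirp /simple_seq mul0r addr0.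
have [->|j0] := eqVneq j 0; first by rewrite expr0n mulr0.
have [n ->] := unit_pow g_gen j0.
by rewrite (cubic_class_pow p_prime p_mod6 g_gen) /chirp_triple /= gv_sqr_mod.
Qed.

Lemma sum_nonzero_gen (F : 'F_p -> R[i]) :
  \sum_(j | j != 0) F j = \sum_(0 <= n < p - 1) F (gv n).
Proof.
rewrite big_mkord -(big_imset _ (h := fun n : 'I_(p - 1) => gv n)) /=; last first.
  move=> n n' _ _ /val_inj/eqP; rewrite eq_expg_mod_order (order_g p_prime g_gen).
  by rewrite !modn_small // => /eqP/val_inj.
apply: eq_bigl => j; apply/idP/imsetP => [j0|[n _ ->]]; last exact: uval_pow_neq0.
have [n ->] := unit_pow g_gen j0.
have lt : (n %% (p - 1) < p - 1)%N by rewrite ltn_pmod // subn_gt0 prime_gt1.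
exists (Ordinal lt) => //; congr FinRing.uval; apply/eqP.
by rewrite eq_expg_mod_order (order_g p_prime g_gen) modn_mod.
Qed.

(** The nonzero squares modulo [7] and their negatives exhaust the nonzero residues, so the left
    side is the sum of all [omega_pow] at nonzero arguments. *)
Lemma sum_chirp_triple m : m != 0 ->
  (\sum_k chirp_triple m k) + (\sum_k chirp_triple m k)^* = -1.
Proof.
move=> m0; have := sum_omega_pow R p_prime m0.
have p6 : (p - 1 = 6)%N by rewrite p7.
rewrite (bigD1 0) //= mulr0 omega_pow0 sum_nonzero_gen p6.
move/eqP; rewrite addrC addr_eq0 => /eqP <-.
rewrite big_nat6.
rewrite !big_I3 /chirp_triple !conjD -!omega_powN //.
have gN n : - gv n = gv (n + 3) by rewrite gvD gv3 mulrN1.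
have -> : gv (0%R : 'I_3) ^+ 2 = gv 0 by rewrite gv_sqr.
have -> : gv (1%R : 'I_3) ^+ 2 = gv 2 by rewrite gv_sqr.
have -> : gv ((-1)%R : 'I_3) ^+ 2 = - gv 1 by rewrite gv_sqr gN.
have -> : gv 3 = - gv 0 by rewrite gN.
have -> : gv 4 = - gv 1 by rewrite gN.
have -> : gv 5 = - gv 2 by rewrite gN.
by rewrite !mulrN opprK; ring.
Qed.

Lemma chirp_triple_Re m a b d : m != 0 ->
  (forall k : 'I_3, chirp_triple m k = cubic_comb a b d k) -> 6 * Re a = -1 :> R.
Proof.
move=> m0 cE; have := sum_chirp_triple m0.
have -> : \sum_k chirp_triple m k = 3 * a.
  rewrite big_I3 !cE; have [-> -> ->] := cubic_combE a b d.
  rewrite -[RHS]addr0 -(mulr0 (b + d)) -(zeta_sum R); ring.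
case: (a) => x y /(congr1 (@complex.Re R)) /= h.
have -> : 6 * x = (1 + 1 + 1) * x - 0 * y + ((1 + 1 + 1) * x - 0 * y) by ring.
by rewrite -[RHS]h /=; ring.
Qed.

(** A shift by [k] multiplies [m] by the square of [g ^+ k], and inversion changes its sign. *)
Lemma orbit_chirp_triple m t : m != 0 ->
  exists2 m', m' != 0 & orbit_triple (chirp_triple m) t =1 chirp_triple m'.
Proof.
move=> m0; case: t => k s.
have gk : gv k ^+ 2 != 0 by rewrite expf_neq0 // uval_pow_neq0.
have kj (j : 'I_3) : m * gv (k + j)%R ^+ 2 = m * gv k ^+ 2 * gv j ^+ 2.
  by rewrite /= gv_sqr_mod gvD exprMn mulrA.
exists (if s then - (m * gv k ^+ 2) else m * gv k ^+ 2).
  by case: s; rewrite ?oppr_eq0 mulf_neq0.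
move=> j; rewrite /orbit_triple /= /chirp_triple kj; case: s => //.
by rewrite div1r invc_norm1 ?omega_pow_norm // -omega_powN // mulNr.
Qed.

End ChirpSeven.

(** * Counting *)

Section Main.
Context (R : realType) (p : nat) (g : {unit 'F_p}) (A B : int).
Hypotheses (p_prime : prime p) (p_mod6 : (p = 1 %[mod 6])%N)
  (g_gen : generator [set: {unit 'F_p}]%SET g)
  (g_choice : (ncoset g (inord 0) (inord 1) < ncoset g (inord 0) (inord 2))%N)
  (AB_eq : 4 * p%:Z = A ^+ 2 + 27 * B ^+ 2)
  (A_mod3 : (A = 1 %[mod 3])%Z) (B_gt0 : 0 < B).
Local Notation P := (p%:R : R).
Local Notation a := (A%:~R : R).
Local Notation h := (3 * Num.sqrt 3 * B%:~R : R).

Definition canonical (i : bool) : 'I_3 -> R[i] :=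
  if i then canonical1 R p A B else canonical2 R p A B.

(** The two branches for [Re a], kept as linear equations with nonzero leading coefficient; they
    label the families. *)
Definition canonical_eq (i : bool) (x : R) : Prop :=
  if i then 2 * (P ^+ 2 - 3 * P - a) * x = P * a - 2 * P - 2 * a
  else 2 * x * (P + 2) + P - 4 = Num.sqrt P * Num.sqrt (P + 4 * a + 16) * (1 - 2 * x).

Lemma p_gt4 : (4 < p)%N.
Proof. by apply: leq_trans (p_ge7 p_prime p_mod6). Qed.

Lemma P_gt4 : 4 < P. Proof. exact: (p_real_gt4 R p_gt4). Qed.

Lemma h_neq0 : h != 0. Proof. exact: lt0r_neq0 (gt0_3sqrt3B R B_gt0). Qed.

Lemma h_sqr : h ^+ 2 = 4 * P - a ^+ 2. Proof. exact: sqr_3sqrt3B AB_eq. Qed.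

Lemma canonical_coords i : exists al be de,
  [/\ solves P a h al be de, canonical_eq i (Re al) &
      canonical i = (fun k : 'I_3 => cubic_comb al be de k)].
Proof.
case: i.
  have [al [be [de [h1 h2 h3]]]] := canonical1_solves R p_gt4 AB_eq B_gt0.
  by exists al, be, de; split=> //; apply: funext.
have [al [be [de [h1 h2 h3]]]] := canonical2_solves R p_gt4 AB_eq B_gt0.
by exists al, be, de; split=> //; apply: funext.
Qed.

Lemma canonical_eq_inj i i' x : canonical_eq i x -> canonical_eq i' x -> i = i'.
Proof.
case: i i' => [] [] // h1 h2; exfalso.
  exact: (Re_distinct p_gt4 AB_eq B_gt0 h1 h2).
exact: (Re_distinct p_gt4 AB_eq B_gt0 h2 h1).
Qed.

Lemma canonical_eq_Re i x y : canonical_eq i x -> canonical_eq i y -> x = y.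
Proof.
case: i => /= h1 h2.
  have D0 : 2 * (P ^+ 2 - 3 * P - a) != 0.
    by rewrite mulf_neq0 ?pnatr_eq0 // lt0r_neq0 // (canonical1_den_gt0 R p_gt4 AB_eq B_gt0).
  by apply: (mulfI D0); rewrite h1 h2.
have E0 : 2 * (P + 2 + Num.sqrt P * Num.sqrt (P + 4 * a + 16)) != 0.
  have uv0 : 0 <= Num.sqrt P * Num.sqrt (P + 4 * a + 16) by rewrite mulr_ge0 ?sqrtr_ge0.
  by rewrite mulf_neq0 ?pnatr_eq0 // lt0r_neq0 //; have := P_gt4; lra.
by apply: (mulfI E0); lra.
Qed.

Lemma canonical_eq_cases al be de : solves P a h al be de ->
  exists i, canonical_eq i (Re al).
Proof.
move=> sol; have [[_ _] uv] := v_bound R p_gt4 AB_eq B_gt0.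
have [h1|h1] := solves_Re_cases P_gt4 h_neq0 h_sqr (sqrt_p_gt0 R p_gt4) (sqr_sqrt_p R p)
  (sqrtr_ge0 _) (sqr_v R p_gt4 AB_eq B_gt0) uv sol; by [exists true|exists false].
Qed.

Definition sol_seq (i : bool) (t : 'I_3 * bool) : 'F_p -> R[i] :=
  simple_seq g (orbit_triple (canonical i) t).

Lemma orbit_canonical i t : exists al be de,
  [/\ solves P a h al be de, canonical_eq i (Re al) &
      forall k : 'I_3, orbit_triple (canonical i) t k = cubic_comb al be de k].
Proof.
have [al [be [de [sol ceq ->]]]] := canonical_coords i.
have [al' [be' [de' [sol' rE cE]]]] := orbit_coords t sol.
by exists al', be', de'; rewrite rE.
Qed.

Lemma simple_seq_ext c c' : c =1 c' -> simple_seq g c = simple_seq g c' :> ('F_p -> R[i]).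
Proof. by move=> cc; congr simple_seq; apply: funext. Qed.

Lemma bi_unimodular_sol i t : bi_unimodular (sol_seq i t).
Proof.
have [al [be [de [sol _ cE]]]] := orbit_canonical i t.
rewrite /sol_seq (simple_seq_ext cE).
exact/(bi_unimodular_simple p_prime p_mod6 g_gen g_choice AB_eq A_mod3 B_gt0).
Qed.

Lemma simple_solution (c : 'I_3 -> R[i]) : bi_unimodular (simple_seq g c) ->
  exists i t, c =1 orbit_triple (canonical i) t.
Proof.
have [al [be [de cE]]] := cubic_comb_surj c.
rewrite (simple_seq_ext cE).
move/(bi_unimodular_simple p_prime p_mod6 g_gen g_choice AB_eq A_mod3 B_gt0) => sol.
have [i iE] := canonical_eq_cases sol.
have [al' [be' [de' [sol' iE' c'E]]]] := canonical_coords i.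
have : triple_from (canonical i) c.
  apply: (solves_orbit P_gt4 h_neq0 sol' sol (canonical_eq_Re iE iE')) => //.
  by rewrite c'E.
by move/triple_fromP => [t tE]; exists i, t.
Qed.

Lemma classification (x : 'F_p -> R[i]) : bi_unimodular x -> index3 g x ->
  exists b r l i t, `|b| = 1 /\ x =1 twist b r l (sol_seq i t).
Proof.
move=> bix /(index3_twist p_prime p_mod6 g_gen (proj1 bix)) [b [r [l [c [b1 xE]]]]].
have xE' : x = twist b r l (simple_seq g c) by apply: funext.
move: bix; rewrite xE' bi_unimodular_twist // => /simple_solution [i [t tE]].
by exists b, r, l, i, t; split=> // j; rewrite /sol_seq (simple_seq_ext tE).
Qed.

(** The scalar is forced by [x_0 = 1], because the translation brings the value at [- l] to the
    origin; modulation, translation and triple remain as parameters. *)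
Definition norm_sol (i : bool) (w : 'F_p * 'F_p * ('I_3 * bool)) : 'F_p -> R[i] :=
  twist (sol_seq i w.2 (- w.1.2))^-1 w.1.1 w.1.2 (sol_seq i w.2).

Lemma norm_sol_coef i (w : 'F_p * 'F_p * ('I_3 * bool)) :
  `|(sol_seq i w.2 (- w.1.2))^-1| = 1.
Proof. by rewrite normfV (proj1 (bi_unimodular_sol i w.2)) invr1. Qed.

Lemma norm_sol_solution i w : normalized_solutions R g (norm_sol i w).
Proof.
split; [| exact: twist_index3 |].
  by apply/bi_unimodular_twist; [exact: p_prime|exact: norm_sol_coef|exact: bi_unimodular_sol].
rewrite /norm_sol /twist mulr0 omega_pow0 mulr1 sub0r mulVf //.
by rewrite -normr_eq0 (proj1 (bi_unimodular_sol i w.2)) oner_eq0.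
Qed.

Lemma twist_norm_sol b r l i t :
  twist b r l (sol_seq i t) 0 = 1 -> twist b r l (sol_seq i t) = norm_sol i (r, l, t).
Proof.
rewrite /norm_sol /twist /= mulr0 omega_pow0 mulr1 sub0r => b1.
have s0 : sol_seq i t (- l) != 0.
  by rewrite -normr_eq0 (proj1 (bi_unimodular_sol i t)) oner_eq0.
have -> // : b = (sol_seq i t (- l))^-1.
by apply: (mulIf s0); rewrite b1 mulVf.
Qed.

Lemma normalized_solutionsP x : normalized_solutions R g x <->
  exists i w, norm_sol i w = x.
Proof.
split=> [[bix ix x0]|[i [w <-]]]; last exact: norm_sol_solution.
have [b [r [l [i [t [b1 xE]]]]]] := classification bix ix.
have tE : twist b r l (sol_seq i t) = x by apply/esym/funext.
by exists i, (r, l, t); rewrite -(@twist_norm_sol b) tE.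
Qed.

Lemma comes_fromP i x : comes_from g (canonical i) x <->
  exists b r l t, `|b| = 1 /\ x =1 twist b r l (sol_seq i t).
Proof.
split.
  case=> c [/triple_fromP [t tE] /(has_formP p_prime p_mod6 g_gen) [b [r [l [b1 xE]]]]].
  by exists b, r, l, t; split=> // j; rewrite xE /sol_seq (simple_seq_ext tE).
case=> b [r [l [t [b1 xE]]]]; exists (orbit_triple (canonical i) t); split.
  by apply/triple_fromP; exists t.
by apply/(has_formP p_prime p_mod6 g_gen); exists b, r, l.
Qed.

Lemma normalized_solutions_fromP i x :
  normalized_solutions_from g (canonical i) x <-> exists w, norm_sol i w = x.
Proof.
split=> [[[_ _ x0] /comes_fromP [b [r [l [t [b1 xE]]]]]]|[w <-]].
  have tE : twist b r l (sol_seq i t) = x by apply/esym/funext.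
  by exists (r, l, t); rewrite -(@twist_norm_sol b) tE.
split; first exact: norm_sol_solution.
apply/comes_fromP; exists (sol_seq i w.2 (- w.1.2))^-1, w.1.1, w.1.2, w.2.
by split=> //; exact: norm_sol_coef.
Qed.

Lemma sol_seq_inj i i' t t' :
  orbit_triple (canonical i) t =1 orbit_triple (canonical i') t' -> i = i' /\ t = t'.
Proof.
move=> e.
have ii : i = i'.
  have [al [be [de [_ ceq cE]]]] := orbit_canonical i t.
  have [al' [be' [de' [_ ceq' cE']]]] := orbit_canonical i' t'.
  have [aa _ _] := cubic_comb_inj (fun k => etrans (esym (cE k)) (etrans (e k) (cE' k))).
  by apply: canonical_eq_inj ceq _; rewrite aa.
split=> //; rewrite -ii in e.
have [al [be [de [sol _ cE]]]] := canonical_coords i; rewrite cE in e.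
exact: (orbit_triple_inj P_gt4 h_neq0 sol e).
Qed.

Lemma norm_sol_eq i i' w w' : norm_sol i w = norm_sol i' w' ->
  (i = i' /\ w = w') \/
  p = 7%N /\ exists2 m : 'F_p, m != 0 & sol_seq i' w'.2 =1 chirp R m 0.
Proof.
case: w w' => [[r l] t] [[r' l'] t'] e.
have := @twist_rigid R p g p_prime p_mod6 g_gen _ _ _ r l _ r' l' (norm_sol_coef i (r, l, t))
  (norm_sol_coef i' (r', l', t')) (bi_unimodular_sol i' t') (fun j => congr1 (@^~ j) e).
case=> [[-> -> /sol_seq_inj [ii tt']]|[p7 [m m0 mE]]].
  by left; split=> //; congr (_, _, _).
by right; split=> //; exists m => // j; rewrite [LHS]mE /chirp mul0r addr0.
Qed.

Lemma card_index : #|{: 'F_p * 'F_p * ('I_3 * bool)}| = (6 * p ^ 2)%N.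
Proof. by rewrite !card_prod card_Fp // card_ord card_bool mulnC expnS expn1. Qed.

Section Seven.
Local Notation nonzero := {m : 'F_p | m != 0%R}.
Hypothesis p7 : p = 7%N.

Lemma A_eq1 : A = 1.
Proof.
have e := AB_eq; rewrite p7 in e.
have B1 : B = 1.
  have [B2|] := leP 2 B; last by have := B_gt0; lia.
  have A0 : 0 <= A ^+ 2 by exact: sqr_ge0.
  have B4 : 4 <= B ^+ 2.
    by rewrite -[4]/(2 ^+ 2 : int) ler_pXn2r // nnegrE; lia.
  by lia.
have : A ^+ 2 = 1 ^+ 2 by rewrite B1 in e; lia.
by move/eqP; rewrite eqf_sqr => /orP[] /eqP // A1; have := A_mod3; rewrite A1.
Qed.

Lemma canonical_eq_seven (x : R) : 6 * x = -1 -> canonical_eq true x.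
Proof. by rewrite /= A_eq1 p7 => x6; lra. Qed.

Lemma chirp_from (m : 'F_p) : m != 0 -> exists t, chirp R m 0 = sol_seq true t.
Proof.
move=> m0; have cs := chirp_simple R p_prime p_mod6 g_gen p7 m.
have [i [t tE]] : exists i t, chirp_triple R g m =1 orbit_triple (canonical i) t.
  apply: simple_solution; have -> : simple_seq g (chirp_triple R g m) = chirp R m 0.
    by apply: funext => j; rewrite cs.
  by apply: chirp_bi_unimodular => //; rewrite p7.
have [al [be [de [_ ceq cE]]]] := orbit_canonical i t.
have a6 := chirp_triple_Re p_prime g_gen p7 m0 (fun k => etrans (tE k) (cE k)).
have it : i = true by apply: canonical_eq_inj ceq (canonical_eq_seven a6).
exists t; apply: funext => j; rewrite cs; rewrite it in tE.
by rewrite /sol_seq (simple_seq_ext tE).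
Qed.

Lemma sol_seq_chirp i t (m : 'F_p) : m != 0 -> sol_seq i t =1 chirp R m 0 -> i = true.
Proof.
move=> /chirp_from [t' ->] e.
by have [] := sol_seq_inj (simple_seq_eq p_prime p_mod6 g_gen e).
Qed.

(** One chirp lies in the first family and the six operations preserve chirps, so the whole family
    consists of chirps. *)
Lemma chirp_sol_seq t : exists2 m : 'F_p, m != 0 & sol_seq true t =1 chirp R m 0.
Proof.
have [s sE] := chirp_from (oner_neq0 'F_p).
have cs := chirp_simple R p_prime p_mod6 g_gen p7.
have sE' : chirp_triple R g 1 =1 orbit_triple (canonical true) s.
  apply: (simple_seq_eq p_prime p_mod6 g_gen) => j.
  by rewrite -cs sE.
have [al [be [de [sol ceq cE]]]] := canonical_coords true.
have [al' [be' [de' [sol' ceq' cE']]]] := orbit_canonical true s.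
have : triple_from (chirp_triple R g 1) (orbit_triple (canonical true) t).
  have [al2 [be2 [de2 [sol2 ceq2 cE2]]]] := orbit_canonical true t.
  apply: (solves_orbit P_gt4 h_neq0 sol' sol2 (canonical_eq_Re ceq2 ceq') _ cE2).
  by move=> k; rewrite sE'.
move=> /triple_fromP [t' tE].
have [m m0 mE] := orbit_chirp_triple R p_prime g_gen p7 t' (oner_neq0 'F_p).
exists m => // j; rewrite cs /sol_seq; congr (_ _).
by apply: simple_seq_ext => k; rewrite tE mE.
Qed.

(** Replaces the redundant parameters of the first family by pairs [(m, n)] without repetition;
    [n = r - 2 m l] absorbs the translation. *)
Lemma norm_sol_true x : (exists w, norm_sol true w = x) <->
  exists mn : nonzero * 'F_p, chirp R (val mn.1) mn.2 = x.
Proof.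
have p3 : (2 < p)%N by rewrite p7.
split=> [[w <-]|[[[m m0] n] /= <-]].
  have [m m0 mE] := chirp_sol_seq w.2.
  exists (exist _ m m0, w.1.1 - 2 * m * w.1.2); apply: funext => j /=.
  have [_ _ n0] := norm_sol_solution true w.
  have sE : sol_seq true w.2 = chirp R m 0 by apply: funext.
  by move: n0; rewrite /norm_sol sE => n0; rewrite twist_chirp.
have [t tE] := chirp_from m0.
have e1 : twist 1 n 0 (sol_seq true t) = chirp R m n.
  by rewrite -tE; apply/esym/funext => j; exact: chirp_twist.
exists (n, 0, t); rewrite -(@twist_norm_sol 1) e1 //.
by rewrite /chirp expr0n !mulr0 addr0.
Qed.

Lemma card_seven_true :
  (normalized_solutions_from g (canonical true) #= `I_(6 * 7))%card.
Proof.
have -> : (6 * 7 = #|{: nonzero * 'F_p}|)%N.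
  by rewrite card_prod card_sig cardC1 card_Fp // p7.
apply: (card_eq_range (f := fun mn : nonzero * 'F_p => chirp R (val mn.1) mn.2)).
  move=> [m n] [m' n'] /= e; have p3 : (2 < p)%N by rewrite p7.
  by have [/val_inj -> ->] := chirp_inj p_prime p3 (fun j => congr1 (@^~ j) e).
by move=> x; rewrite normalized_solutions_fromP norm_sol_true.
Qed.

Lemma norm_sol_false_inj : injective (norm_sol false).
Proof.
move=> w w' /norm_sol_eq [[_ //]|[_ [m m0 mE]]].
by have := sol_seq_chirp m0 mE.
Qed.

Lemma card_seven_false :
  (normalized_solutions_from g (canonical false) #= `I_(6 * 7 ^ 2))%card.
Proof.
have -> : (6 * 7 ^ 2 = #|{: 'F_p * 'F_p * ('I_3 * bool)}|)%N by rewrite card_index p7.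
by apply: (card_eq_range norm_sol_false_inj) => x; exact: normalized_solutions_fromP.
Qed.

Lemma card_seven : (normalized_solutions R g #= `I_336)%card.
Proof.
(* [336 = 6 * 7 ^ 2 + 6 * 7]: the second family keeps its own parameters, while chirps stand for the
   first. *)
pose T : finType := (('F_p * 'F_p * ('I_3 * bool)) + (nonzero * 'F_p))%type.
have -> : (336 = #|T|)%N.
  by rewrite card_sum card_index card_prod card_sig cardC1 card_Fp // p7.
pose f (w : T) := match w with
  | inl w => norm_sol false w | inr mn => chirp R (val mn.1) mn.2 end.
have disj w (mn : nonzero * 'F_p) : norm_sol false w <> chirp R (val mn.1) mn.2.
  move=> e; have [w' wE] : exists w', norm_sol true w' = norm_sol false w.
    by apply/norm_sol_true; exists mn.
  have [[]//|[_ [m m0 mE]]] := norm_sol_eq wE.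
  by have := sol_seq_chirp m0 mE.
apply: (card_eq_range (f := f)).
  move=> [w|[m n]] [w'|[m' n']] //= e.
  - by rewrite (norm_sol_false_inj e).
  - by case: (disj w (m', n')).
  - by case: (disj w' (m, n)); rewrite -e.
  - have p3 : (2 < p)%N by rewrite p7.
    by have [/val_inj -> ->] := chirp_inj p_prime p3 (fun j => congr1 (@^~ j) e).
move=> x; rewrite normalized_solutionsP; split.
  case=> -[] [w wE]; last by exists (inl w).
  have [mn mnE] : exists mn : nonzero * 'F_p, chirp R (val mn.1) mn.2 = x.
    by apply/norm_sol_true; exists w.
  by exists (inr mn).
case=> -[w|mn] wE; first by exists false, w.
by exists true; apply/norm_sol_true; exists mn.
Qed.

Lemma seven_chirp_unique x :
  normalized_solutions_from g (canonical true) x ->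
  exists! mn : 'F_p * 'F_p, mn.1 != 0 /\
    forall j : 'F_p, x j = omega_pow R (mn.1 * j ^+ 2 + mn.2 * j).
Proof.
move=> /normalized_solutions_fromP/norm_sol_true [[[m m0] n] /= <-].
exists (m, n); split=> //= -[m' n'] /= [_ e].
by have p3 : (2 < p)%N; [rewrite p7|exact: (@chirp_inj _ _ p_prime p3 _ _ m' n' e)].
Qed.

End Seven.

Lemma card_not_seven : p <> 7%N -> (normalized_solutions R g #= `I_(12 * p ^ 2))%card.
Proof.
move=> p7.
have -> : (12 * p ^ 2 = #|{: bool * ('F_p * 'F_p * ('I_3 * bool))}|)%N.
  by rewrite card_prod card_index card_bool mulnA.
apply: (card_eq_range (f := fun w => norm_sol w.1 w.2)).
  by move=> [i w] [i' w'] /= /norm_sol_eq [[-> ->]|[/p7]].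
move=> x; rewrite normalized_solutionsP; split=> [[i [w wE]]|[[i w] wE]].
  by exists (i, w).
by exists i, w.
Qed.

Lemma has_form_canonical x : bi_unimodular x -> index3 g x ->
  exists c, (triple_from (canonical1 R p A B) c \/ triple_from (canonical2 R p A B) c) /\
    has_form g c x.
Proof.
move=> bix ix; have [b [r [l [i [t [b1 xE]]]]]] := classification bix ix.
exists (orbit_triple (canonical i) t); split.
  by case: (i); [left|right]; apply/triple_fromP; exists t.
by apply/(has_formP p_prime p_mod6 g_gen); exists b, r, l.
Qed.

End Main.

Theorem proposition5p2 (R : realType) (p : nat) (g : {unit 'F_p}) (A B : int)
    (p_prime : prime p) (p_mod6 : (p = 1 %[mod 6])%N)
    (g_gen : generator [set: {unit 'F_p}]%SET g)
    (g_choice : (ncoset g (inord 0) (inord 1)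
                 < ncoset g (inord 0) (inord 2))%N)
    (AB_eq : 4 * p%:Z = A ^+ 2 + 27 * B ^+ 2)
    (A_mod3 : (A = 1 %[mod 3])%Z)
    (B_gt0 : 0 < B) :
  [/\ (forall x : 'F_p -> R[i], bi_unimodular x -> index3 g x ->
         exists c : 'I_3 -> R[i],
           (triple_from (canonical1 R p A B) c \/
            triple_from (canonical2 R p A B) c) /\
           has_form g c x),
      (p <> 7%N -> (normalized_solutions R g #= `I_(12 * p ^ 2))%card) &
      (p = 7%N ->
         [/\ (normalized_solutions R g #= `I_336)%card,
             (normalized_solutions_from g (canonical2 R p A B)
                #= `I_(6 * 7 ^ 2))%card,
             (normalized_solutions_from g (canonical1 R p A B)
                #= `I_(6 * 7))%card &
             (forall x : 'F_p -> R[i],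
                normalized_solutions_from g (canonical1 R p A B) x ->
                exists! mn : 'F_p * 'F_p,
                  mn.1 != 0 /\
                  forall j : 'F_p,
                    x j = omega_pow R (mn.1 * j ^+ 2 + mn.2 * j))])].

Proof.
split.
- exact: (has_form_canonical p_prime p_mod6 g_gen g_choice AB_eq A_mod3 B_gt0).
- exact: (card_not_seven R p_prime p_mod6 g_gen g_choice AB_eq A_mod3 B_gt0).
- move=> p7; split.
  + exact: (card_seven R p_prime p_mod6 g_gen g_choice AB_eq A_mod3 B_gt0 p7).
  + exact: (card_seven_false R p_prime p_mod6 g_gen g_choice AB_eq A_mod3 B_gt0 p7).
  + exact: (card_seven_true R p_prime p_mod6 g_gen g_choice AB_eq A_mod3 B_gt0 p7).
  + exact: (seven_chirp_unique p_prime p_mod6 g_gen g_choice AB_eq A_mod3 B_gt0 p7).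
Qed.
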